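(* Let $D$ be an alternating dimap. Then the $M$-polynomial $M_{D,r}(x_1,\dots,x_k)$ is independent of the choice of root $r\in V(D)$. Moreover, the resulting polynomial $M_D(\mathbf{x})=M_{D,r}(\mathbf{x})$ is denormalized Lorentzian.
   Context: Alternating dimaps. An alternating dimap $D$ is a (finite) Eulerian digraph embedded in the plane and oriented so that the edges around each vertex are directed alternately into and out of that vertex. Its faces are called regions. The faces are 2-colorable: the edges surrounding faces of one color form clockwise oriented cycles, and those surrounding faces of the other color form counterclockwise oriented cycles; here a region counts as clockwise oriented when it lies to the right of each of its boundary edges (so the exterior region may be a clockwise oriented region). Let $R(D)=\{R_1,\dots,R_k\}$ be the set of clockwise oriented regions. Each edge $e$ of $D$ lies in the boundary of exactly one region $R_i\in R(D)$; put $var(e)=x_i$. $M$-polynomial. An arborescence of $D$ rooted at a vertex $r$ is a spanning tree in which there is a unique directed path from $r$ to every vertex. Define $$M_{D,r}(x_1,\dots,x_k)=\sum_{A}\prod_{e\in E(A)}var(e),$$ the sum over all arborescences $A$ of $D$ rooted at $r$. Lorentzian polynomials. Let $\mathbb{N}=\{0,1,2,\dots\}$ and $e_i$ the $i$th standard basis vector. A set $J\subseteq\mathbb{N}^n$ is M-convex if for every index $i$ and all $\alpha,\beta\in J$ with $\alpha_i>\beta_i$ there is an index $j$ with $\alpha_j<\beta_j$, $\alpha-e_i+e_j\in J$ and $\beta-e_j+e_i\in J$. Let $\mathrm{H}^d_n$ be the space of homogeneous degree $d$ real polynomials in $x_1,\dots,x_n$. The support of a polynomial is the set of exponent vectors of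 monomials with nonzero coefficient. Let $\mathrm{M}^d_n\subseteq \mathrm{H}^d_n$ be the polynomials with nonnegative coefficients and M-convex support. The set $\mathrm{L}^d_n$ of Lorentzian polynomials is: $\mathrm{L}^0_n$ the nonnegative constants; $\mathrm{L}^1_n$ the linear forms with nonnegative coefficients; $\mathrm{L}^2_n$ the quadratic forms in $\mathrm{M}^2_n$ whose Hessian matrix $\left(\frac{\partial}{\partial x_i}\frac{\partial}{\partial x_j}f\right)_{i,j}$ has at most one positive eigenvalue; and for $d>2$, $\mathrm{L}^d_n=\{f\in \mathrm{M}^d_n:\frac{\partial}{\partial x_i}f\in \mathrm{L}^{d-1}_n\text{ for all }i\}$. The normalization operator $N$ is the linear operator on $\mathbb{R}[x_1,\dots,x_n]$ with $N(\mathbf{x}^\alpha)=\mathbf{x}^\alpha/\alpha!$, where $\alpha!=\prod_i\alpha_i!$. A polynomial $f\in \mathrm{H}^d_n$ is denormalized Lorentzian if $N(f)\in \mathrm{L}^d_n$. *)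

(* Defs.v *)
From HB Require Import structures.
From mathcomp Require Import all_boot all_order all_algebra all_fingroup.
From mathcomp Require Import boolp reals.
From mathcomp Require Import mpoly.

Set Implicit Arguments.
Unset Strict Implicit.
Unset Printing Implicit Defensive.

Import Order.TTheory GRing.Theory Num.Theory.

Local Open Scope ring_scope.

(* Plane digraphs are encoded as combinatorial maps.  Each edge e consists of *)
(* two darts: (e, true) sits at the tail of e and points along e, and         *)
(* (e, false) sits at the head of e and points against e.                     *)
Definition dart (E : finType) : finType := (E * bool)%type.

Definition flip_fun (E : finType) (d : dart E) : dart E := (d.1, ~~ d.2).

Lemma flip_funK (E : finType) : involutive (@flip_fun E).
Proof. by case=> e b; rewrite /flip_fun /= negbK. Qed.

Definition flip (E : finType) : {perm dart E} :=
  perm (inv_inj (@flip_funK E)).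

(* When rot turns the darts counterclockwise around their vertices,           *)
(* d |-> rot (flip d) walks to the other end of d and then takes the first    *)
(* turn to the right: it runs along the boundary of the face lying to the     *)
(* right of d.                                                                *)
Definition face_perm (E : finType) (rot : {perm dart E}) : {perm dart E} :=
  (flip E * rot)%g.

Definition dart_link (E : finType) (rot : {perm dart E}) : rel (dart E) :=
  fun d d' => (rot d == d') || (flip E d == d').

(* A rotation system determines an embedding of each component (with at least *)
(* one edge) in a closed oriented surface; the embedding is planar iff        *)
(* V - E + F = 2 holds for each component.  Since V - E + F <= 2 always holds *)
(* for a component, it suffices to sum these equations.  Isolated vertices    *)
(* carry no darts, so they do not contribute.                                 *)
Definition planar_rot (E : finType) (rot : {perm dart E}) : Prop :=
  (#|porbits rot| + #|porbits (face_perm rot)|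
     = #|E| + 2 * n_comp (dart_link rot) predT)%N.

(* In-degree = out-degree at each vertex follows from ad_alternating: rot     *)
(* exchanges the outgoing and the incoming darts at each vertex.  The choice  *)
(* of the exterior face is not recorded, because being to the right of an     *)
(* edge does not depend on it.                                                *)
Record alternating_dimap := AlternatingDimap {
  ad_vertex : finType;
  ad_edge : finType;
  ad_tail : ad_edge -> ad_vertex;
  ad_head : ad_edge -> ad_vertex;
  ad_rot : {perm dart ad_edge};
  ad_rot_vertex : forall d d' : dart ad_edge,
    ((if d.2 then ad_tail d.1 else ad_head d.1)
       == (if d'.2 then ad_tail d'.1 else ad_head d'.1))
      = (d' \in porbit ad_rot d);
  ad_alternating : forall d : dart ad_edge, (ad_rot d).2 = ~~ d.2;
  ad_planar : planar_rot ad_rot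
}.

Section Regions.
Variable D : alternating_dimap.

Definition dart_vertex (d : dart (ad_edge D)) : ad_vertex D :=
  if d.2 then ad_tail d.1 else ad_head d.1.

(* A region is identified with its boundary, namely the set of darts that     *)
(* have it on their right.  If (e, true) is in the boundary then the region   *)
(* lies to the right of e, and if (e, false) is, then to the left of e.       *)
Definition regions : {set {set dart (ad_edge D)}} :=
  porbits (face_perm (ad_rot D)).

Definition cw_regions : {set {set dart (ad_edge D)}} :=
  [set F in regions | [forall d in F, d.2]].

Definition cw_region_of (e : ad_edge D) : {set dart (ad_edge D)} :=
  porbit (face_perm (ad_rot D)) (e, true).

Lemma cw_region_ofP (e : ad_edge D) : cw_region_of e \in cw_regions.
Proof.
rewrite inE /cw_region_of imset_f //=; apply/forall_inP => d /porbitP [i ->].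
elim: i => [|i IHi]; first by rewrite expg0 perm1.
by rewrite expgSr permM permM ad_alternating permE /= negbK.
Qed.

(* The numbering R_1, ..., R_k is the enumeration of the finite set           *)
(* cw_regions.                                                                *)
Definition region_index (e : ad_edge D) : 'I_#|cw_regions| :=
  enum_rank_in (cw_region_ofP e) (cw_region_of e).

Definition var (R : nzRingType) (e : ad_edge D) : {mpoly R[#|cw_regions|]} :=
  'X_(region_index e).

End Regions.

Section Arborescences.
Variable D : alternating_dimap.
Implicit Types (A : {set ad_edge D}) (r u v : ad_vertex D).

Definition und_adj A : rel (ad_vertex D) := fun u v =>
  [exists d : dart (ad_edge D),
     [&& d.1 \in A, dart_vertex d == u & dart_vertex (flip _ d) == v]].

Definition dart_next : rel (dart (ad_edge D)) := fun d d' =>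
  dart_vertex (flip _ d) == dart_vertex d'.

(* Undirected cycles of the multigraph; a loop is a cycle of length 1 and two *)
(* parallel edges form a cycle of length 2.                                   *)
Definition und_cycle A (c : seq (dart (ad_edge D))) : bool :=
  [&& c != [::], all (fun d => d.1 \in A) c, path.cycle dart_next c,
      uniq [seq d.1 | d <- c] & uniq [seq dart_vertex d | d <- c]].

Definition spanning_tree A : Prop :=
  (forall u v, connect (und_adj A) u v) /\ (forall c, ~~ und_cycle A c).

Fixpoint diwalk u (p : seq (ad_edge D)) v : bool :=
  if p is e :: p' then (ad_tail e == u) && diwalk (ad_head e) p' v else u == v.

Definition dipath A u (p : seq (ad_edge D)) v : bool :=
  [&& all (mem A) p, diwalk u p v & uniq (u :: [seq ad_head e | e <- p])].

Definition arborescence A r : Prop :=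
  spanning_tree A /\ (forall v, exists! p, dipath A r p v).

Definition M_poly (R : nzRingType) r : {mpoly R[#|cw_regions D|]} :=
  \sum_(A : {set ad_edge D} | `[< arborescence A r >]) \prod_(e in A) var R e.

End Arborescences.

Definition M_convex (n : nat) (J : 'X_{1..n} -> Prop) : Prop :=
  forall (i : 'I_n) (a b : 'X_{1..n}), J a -> J b -> (b i < a i)%N ->
    exists j : 'I_n, [/\ (a j < b j)%N,
      J (a - U_(i) + U_(j))%MM & J (b - U_(j) + U_(i))%MM].

Section Lorentzian.
Variables (R : realType) (n : nat).
Implicit Type f : {mpoly R[n]}.

Definition nonneg_coef f : Prop := forall m : 'X_{1..n}, 0 <= f@_m.

Definition M_class (d : nat) f : Prop :=
  [/\ f \is d.-homog, nonneg_coef f & M_convex (fun m => m \in msupp f)].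

(* The second derivatives of a quadratic form are constants, represented here *)
(* by their constant coefficients.                                            *)
Definition hessian f : 'M[R]_n :=
  \matrix_(i, j) ((f^`M(j))^`M(i))@_0%MM.

(* The list s contains the eigenvalues repeated according to multiplicity.    *)
Definition at_most_one_pos_eigenvalue (A : 'M[R]_n) : Prop :=
  exists s : seq R, char_poly A = \prod_(a <- s) ('X - a%:P)
    /\ (count (fun a => (0 < a)%R) s <= 1)%N.

Fixpoint lorentzian (d : nat) f : Prop :=
  match d with
  | 0 => exists c : R, 0 <= c /\ f = c%:MP
  | 1 => f \is 1.-homog /\ nonneg_coef f
  | 2 => M_class 2 f /\ at_most_one_pos_eigenvalue (hessian f)
  | d'.+1 => M_class d f /\ forall i : 'I_n, lorentzian d' f^`M(i)
  end.

Definition mfactorial (m : 'X_{1..n}) : nat := (\prod_(i < n) (m i)`!)%N.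

Definition normalization f : {mpoly R[n]} :=
  \sum_(m <- msupp f) (f@_m / (mfactorial m)%:R) *: 'X_[m].

Definition denormalized_lorentzian f : Prop :=
  exists d : nat, f \is d.-homog /\ lorentzian d (normalization f).

End Lorentzian.

(* Main.v *)
(* Let g(I) be the rank, in the graphic matroid of D, of the set of edges on the
   boundaries of the clockwise regions in I.  The exponent vectors of the
   arborescences rooted at r are exactly the lattice points of the base polytope
   of the submodular function g if g(all) = |V| - 1, and there are none
   otherwise; each is attained by exactly one arborescence.  So all coefficients
   of M_{D,r} are 0 or 1, and they do not depend on r.

   Existence: a lattice point satisfies Hall's condition, so it is the exponent
   vector of a choice of one entering edge for each vertex other than r.
   Replacing each edge of a directed cycle of the choice by its predecessor on
   its region keeps the exponent vector; were this never to produce an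
   arborescence, the regions involved in a period of the process would violate
   the inequality g(I) < |vertices on I|.

   Uniqueness: the difference z of the indicators of two arborescences with the
   same exponent vector sums to zero over the edges entering a vertex and over
   each clockwise region.  By planarity z(e) = c(e) - c(next edge on the region
   of e) for a potential c on the counterclockwise regions.  Following the first
   arborescence towards the root shows that c is maximal around r, and following
   the second that it is minimal there, so z = 0.

   Lorentzian property: the lattice points of a base polytope form an M-convex
   set J, and N(M_D) is the sum of x^a / a! over J.  The derivatives have the
   same shape, and the Hessian of such a quadratic form is u^T u, where u is the
   indicator of the nonzero rows, minus the matrix of the relation between
   nonzero rows i and j that entry (i, j) vanishes.  M-convexity makes this
   relation transitive, so its matrix is positive semidefinite. *)

Require Import Defs.
From mathcomp Require Import all_boot all_order all_algebra all_fingroup.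
From mathcomp Require Import boolp reals.
From mathcomp Require Import mpoly.
From mathcomp Require Import spectral sesquilinear complex.
From mathcomp Require Import zify ring.

Set Implicit Arguments.
Unset Strict Implicit.
Unset Printing Implicit Defensive.

Import Order.TTheory GRing.Theory Num.Theory.

Local Open Scope ring_scope.

(** * Symmetric matrices with at most one positive eigenvalue *)

Lemma sum_enum_rank (W : nmodType) (T : finType) (F : 'I_#|T| -> W) :
  \sum_j F j = \sum_x F (enum_rank x).
Proof. by rewrite (reindex enum_rank) //; exact: onW_bij (enum_rank_bij _). Qed.

(* The off-diagonal entry (i, j) vanishes and both diagonal entries are
   positive, which contradicts the Cauchy-Schwarz inequality for T. *)
Lemma gram_diff_one_pos (C : numClosedFieldType) n m (s : 'cV[C]_n)
    (T : 'M[C]_(n, m)) (d : 'rV[C]_n) (i j : 'I_n) :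
  diag_mx d = s *m map_mx Num.conj s^T - T *m map_mx Num.conj T^T ->
  i != j -> 0 < d 0 i -> 0 < d 0 j -> False.
Proof.
move=> eq_d neq_ij di dj.
have entry k l : d 0 k *+ (k == l) =
    s k 0 * (s l 0)^* - dotmx (row k T) (row l T).
  have /matrixP/(_ k l) := eq_d; rewrite !mxE => ->.
  rewrite big_ord1 !mxE dotmxE mxE; congr (_ - _).
  by apply: eq_bigr => p _; rewrite !mxE.
have norm_lt k : 0 < d 0 k -> dotmx (row k T) (row k T) < `|s k 0| ^+ 2.
  by have := entry k k; rewrite eqxx mulr1n normCK => ->; rewrite subr_gt0.
have /eqP := entry i j.
rewrite (negPf neq_ij) mulr0n eq_sym subr_eq0 => /eqP eq_ij.
have : `|dotmx (row i T) (row j T)| ^+ 2 <=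
    dotmx (row i T) (row i T) * dotmx (row j T) (row j T).
  by case: (CauchySchwarz (@dotmx C m) (row i T) (row j T)).
rewrite -eq_ij normrM norm_conjC exprMn => /le_lt_trans.
move=> /(_ (`|s i 0| ^+ 2 * `|s j 0| ^+ 2)); rewrite ltxx => contra.
suff: false by []; apply: contra.
apply: ltr_pM; rewrite ?norm_lt //; exact: dnorm_ge0.
Qed.

Lemma char_poly_conj (F : fieldType) n (P A : 'M[F]_n) :
  P \in unitmx -> char_poly (invmx P *m A *m P) = char_poly A.
Proof.
move=> Pu; rewrite /char_poly.
have -> : char_poly_mx (invmx P *m A *m P) =
   map_mx polyC (invmx P) *m char_poly_mx A *m map_mx polyC P.
  rewrite /char_poly_mx !map_mxM mulmxBr mulmxBl; congr (_ - _).
  by rewrite scalar_mxC -mulmxA -map_mxM mulVmx // map_mx1 mulmx1.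
rewrite !det_mulmx mulrAC -det_mulmx -map_mxM mulVmx // map_mx1 det1.
by rewrite mul1r.
Qed.

(** A unitary matrix over the complex numbers diagonalises this real symmetric matrix. Conjugation
    keeps the shape of a Gram matrix of one column minus a Gram matrix, so [gram_diff_one_pos]
    excludes two positive diagonal entries. *)
Lemma at_most_one_pos_gram (R : realType) n m (v : 'rV[R]_n) (B : 'M[R]_(m, n)) :
  at_most_one_pos_eigenvalue (v^T *m v - B^T *m B).
Proof.
set A := _ - _; pose f := complex.real_complex R.
pose Ac := map_mx f A.
have f_real x : f x \is Num.real by apply/complex.complex_realP; exists x.
have conj_f p q (M : 'M[R]_(p, q)) : map_mx Num.conj (map_mx f M) = map_mx f M.
  by apply/realmxC/mxOverP => i j; rewrite mxE.
have Asym : Ac \is symmetricmx.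
  apply/is_hermitianmxP; rewrite expr0 scale1r.
  rewrite /= map_mx_id // /Ac map_trmx; congr map_mx.
  by rewrite /A linearB /= !trmx_mul !trmxK.
have Areal : Ac \is a mxOver Num.real by apply/mxOverP => i j; rewrite mxE.
have /orthomx_spectralP := symmetric_normalmx Asym Areal.
have := spectral_unitarymx Ac.
have := hermitian_spectral_diag_real (realsym_hermsym Asym Areal).
move: (spectralmx Ac) (spectral_diag Ac) => P d /mxOverP dreal Pu Aeq.
have Puu := unitarymx_unit Pu.
pose a i := complex.Re (d 0 i).
have fa i : d 0 i = f (a i) by rewrite /f complex.RRe_real.
exists [seq a i | i : 'I_n]; split.
  apply: (map_poly_inj f); rewrite map_char_poly /= -/Ac Aeq char_poly_conj //.
  rewrite char_poly_trig ?diag_mx_is_trig // rmorph_prod /= big_map big_enum /=.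
  apply: eq_bigr => i _; rewrite mxE eqxx mulr1n rmorphB /= map_polyX map_polyC.
  by rewrite fa.
rewrite leqNgt; apply/negP; rewrite count_map.
rewrite -sum1_count big_enum_cond /= sum1dep_card => /card_gt1P [i [j []]].
rewrite !inE /= => ai aj neq_ij.
have f_gt0 k : 0 < a k -> 0 < d 0 k by rewrite fa complex.ltcR.
apply: (@gram_diff_one_pos _ n m (P *m map_mx f v^T) (P *m map_mx f B^T) d i j).
- have -> : diag_mx d = P *m Ac *m invmx P.
    by rewrite Aeq !mulmxA mulmxV // mul1mx -mulmxA mulmxV // mulmx1.
  rewrite invmx_unitary // !trmx_mul !map_mxM -!map_trmx !trmxK !conj_f.
  rewrite /Ac /A map_mxB !map_mxM mulmxBr mulmxBl !mulmxA.
  by rewrite -!(map_trmx f).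
- exact: neq_ij.
- exact: f_gt0.
- exact: f_gt0.
Qed.

(** * Indicator polynomials of M-convex sets *)

Section IndicatorPolynomial.
Variables (R : realType) (n : nat).
Implicit Types (f : {mpoly R[n]}) (P : pred 'X_{1..n}).

Lemma mfactorial_gt0 (m : 'X_{1..n}) : (0 < mfactorial m)%N.
Proof. by rewrite prodn_cond_gt0 // => i _; exact: fact_gt0. Qed.

Lemma mfactorialDU (m : 'X_{1..n}) i :
  mfactorial (m + U_(i))%MM = ((m i).+1 * mfactorial m)%N.
Proof.
rewrite /mfactorial (bigD1 i) //= [in RHS](bigD1 i) //= mulnA.
rewrite mnmDE mnm1E eqxx addn1 factS; congr (_ * _)%N.
by apply: eq_bigr => j ji; rewrite mnmDE mnm1E eq_sym (negPf ji) addn0.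
Qed.

Lemma mcoeff_normalization f m :
  (normalization f)@_m = f@_m / (mfactorial m)%:R.
Proof.
rewrite /normalization raddf_sum /=.
under eq_bigr => k _ do rewrite mcoeffZ mcoeffX.
have [fm|fm] := boolP (m \in msupp f).
  rewrite (bigD1_seq m) //= ?msupp_uniq // eqxx mulr1 big1 ?addr0 // => k km.
  by rewrite (negPf km) mulr0.
rewrite (eqP (_ : f@_m == 0)) ?mcoeff_eq0 // mul0r big_seq big1 // => k kf.
have km : k != m by apply: contraNneq fm => <-.
by rewrite (negPf km) mulr0.
Qed.

(** The shifted set is the support of the derivative in [x_i], as needed for the induction on the
    degree. *)
Lemma M_convex_shift P i :
  M_convex P -> M_convex (fun m => P (m + U_(i))%MM).
Proof.
move=> Pconv k a b Pa Pb lt_ba.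
have [|j [lt_ab Pa' Pb']] := Pconv k _ _ Pa Pb.
  by rewrite !mnmDE ltn_add2r.
move: lt_ab; rewrite !mnmDE ltn_add2r => lt_ab; exists j; split=> //.
  rewrite [X in P X](_ : _ = a + U_(i) - U_(k) + U_(j))%MM //.
  by apply/mnmP => l; rewrite !(mnmDE, mnmBE) !mnm1E; case: (k =P l) => [<-|_]; lia.
rewrite [X in P X](_ : _ = b + U_(i) - U_(j) + U_(k))%MM //.
by apply/mnmP => l; rewrite !(mnmDE, mnmBE) !mnm1E; case: (j =P l) => [<-|_]; lia.
Qed.

Lemma quadratic_indicator_sig P f :
  M_convex P -> (forall m, P m -> mdeg m = 2) ->
  (forall i j, (hessian f) i j = (P (U_(i) + U_(j))%MM)%:R) ->
  at_most_one_pos_eigenvalue (hessian f).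
Proof.
move=> Pconv Pdeg hessE; pose H i j := P (U_(i) + U_(j))%MM.
have Hsym i j : H i j = H j i by rewrite /H addmC.
pose supp i := [exists j, H i j].
pose parallel i j := [&& supp i, supp j & ~~ H i j].
have par_sym i j : parallel i j = parallel j i.
  by rewrite /parallel Hsym andbCA.
(* Were entry [(i, k)] nonzero, M-convexity applied to a monomial [x_j x_l] of the support and to
   [x_i x_k] would put [x_i x_j] or [x_j x_k] into the support. *)
have par_trans i j k : parallel i j -> parallel j k -> parallel i k.
  case/and3P=> si sj nij /and3P[_ sk njk]; rewrite /parallel si sk /=.
  apply/negP => Hik; case/existsP: sj => l Hjl.
  have ji : j != i by apply: contra nij => /eqP ji; move: njk; rewrite ji Hik.
  have jk : j != k by apply: contra njk => /eqP jk; move: nij; rewrite jk Hik.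
  have [|m [lt_m Pm _]] := Pconv j _ _ Hjl Hik.
    by rewrite !mnmDE !mnm1E eqxx !(eq_sym _ j) (negPf ji) (negPf jk).
  have [|m' [lt_m' _ Pm']] := Pconv j _ _ Hjl Hik.
    by rewrite !mnmDE !mnm1E eqxx !(eq_sym _ j) (negPf ji) (negPf jk).
  have : (m' == i) || (m' == k).
    move: lt_m'; rewrite !mnmDE !mnm1E !(eq_sym _ m').
    by case: (m' == i); case: (m' == k) => //; lia.
  case/orP => /eqP m'E; rewrite {}m'E in Pm'.
    move/negP: njk; apply; rewrite Hsym /H.
    rewrite [X in P X](_ : _ = U_(i) + U_(k) - U_(i) + U_(j))%MM //.
    by apply/mnmP => p; rewrite !(mnmDE, mnmBE); lia.
  move/negP: nij; apply; rewrite /H.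
  rewrite [X in P X](_ : _ = U_(i) + U_(k) - U_(k) + U_(j))%MM //.
  by apply/mnmP => p; rewrite !(mnmDE, mnmBE); lia.
(* An index in the support with nonzero diagonal entry has an empty class. *)
pose cl i := [set j | parallel i j].
pose v : 'rV[R]_n := \row_i (supp i)%:R.
(* Rows are indexed by all sets of indices, but only nonempty classes give nonzero rows, namely
   their indicators; so [B^T *m B] is the matrix of [parallel]. *)
pose B : 'M[R]_(#|{set 'I_n}|, n) :=
  \matrix_(S, i) ((enum_val S == cl i) && (cl i != set0))%:R.
have -> : hessian f = v^T *m v - B^T *m B; last exact: at_most_one_pos_gram.
apply/matrixP => i j; rewrite hessE -/(H i j) !mxE big_ord1 !mxE.
rewrite sum_enum_rank /=.
rewrite (bigD1 (cl i)) //= big1 ?addr0 => [|S Si]; last first.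
  by rewrite !mxE enum_rankK (negPf Si) mul0r.
rewrite !mxE enum_rankK eqxx /= -!natrM !mulnb.
have -> : [&& cl i != set0, cl i == cl j & cl j != set0] = parallel i j.
  apply/and3P/idP => [[_ /eqP eq_cl /set0Pn[k]]|pij].
    move=> jk; have := jk; rewrite -eq_cl inE => /par_trans; apply.
    by rewrite par_sym; move: jk; rewrite inE.
  have eq_cl : cl i = cl j.
    apply/setP => k; rewrite !inE; apply/idP/idP; last exact: par_trans.
    by apply: par_trans; rewrite par_sym.
  rewrite -eq_cl eqxx; have: cl i != set0 by apply/set0Pn; exists j; rewrite inE.
  by [].
rewrite /parallel; have [si|] /= := boolP (supp i); last first.
  move/existsPn/(_ j)/negPf ->; by rewrite subr0.
have [sj|] /= := boolP (supp j); last first.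
  move/existsPn/(_ i)/negPf; rewrite Hsym => ->; by rewrite subr0.
by case: (H i j); rewrite ?subr0 ?subrr.
Qed.

Lemma lorentzian_indicator d P f :
  M_convex P -> (forall m, P m -> mdeg m = d) ->
  (forall m, f@_m = (P m)%:R / (mfactorial m)%:R) -> lorentzian d f.
Proof.
have fact_neq0 (m : 'X_{1..n}) : (mfactorial m)%:R != 0 :> R.
  by rewrite pnatr_eq0 -lt0n mfactorial_gt0.
have suppP P' f' : (forall m, f'@_m = (P' m)%:R / (mfactorial m)%:R) ->
    forall m, (m \in msupp f') = P' m.
  move=> fE m; rewrite mcoeff_msupp fE mulf_eq0 invr_eq0 (negPf (fact_neq0 m)).
  by rewrite orbF pnatr_eq0 eqb0 negbK.
elim: d P f => [|d IHd] P f Pconv Pdeg fE.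
  exists f@_0%MM; split; first by rewrite fE divr_ge0 ?ler0n.
  apply/mpolyP => m; rewrite mcoeffC.
  have [->|m0] := eqVneq m 0%MM; first by rewrite mulr1.
  rewrite mulr0 fE; case: (boolP (P m)) => [/Pdeg/eqP|]; last by rewrite mul0r.
  by rewrite mdeg_eq0 (negPf m0).
have fhom : f \is d.+1.-homog.
  by apply/dhomogP => m; rewrite (suppP _ _ fE); exact: Pdeg.
have fnn : nonneg_coef f by move=> m; rewrite fE divr_ge0 ?ler0n.
have fM : M_class d.+1 f.
  split=> // i a b; rewrite !(suppP _ _ fE) => Pa Pb lt_ba.
  have [j [ltj Pj1 Pj2]] := Pconv i a b Pa Pb lt_ba.
  by exists j; rewrite !(suppP _ _ fE).
(* The factor [m i + 1] from differentiation cancels against the factorial of the larger exponent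
   vector. *)
have derE i m : f^`M(i)@_m = (P (m + U_(i))%MM)%:R / (mfactorial m)%:R.
  rewrite mcoeff_mderiv fE mfactorialDU -(mulr_natr _ (m i).+1) natrM invfM.
  by rewrite -mulrA mulrAC mulVf ?mul1r // pnatr_eq0.
case: d IHd Pdeg fhom fM => [|[|d]] IHd Pdeg fhom fM //; split=> //.
  apply: quadratic_indicator_sig (Pconv) (Pdeg) _ => i j.
  rewrite mxE mcoeff_mderiv derE mnm0E mulr1n add0m addmC.
  suff -> : mfactorial U_(i)%MM = 1%N by rewrite divr1.
  rewrite -[U_(i)%MM]add0m mfactorialDU mnm0E mul1n.
  by rewrite /mfactorial big1 // => k _; rewrite mnm0E.
move=> i; apply: (IHd (fun m => P (m + U_(i))%MM)) => [|m /Pdeg|m].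
- exact: M_convex_shift.
- by rewrite mdegD mdeg1 addn1 => -[].
- exact: derE.
Qed.

Lemma denormalized_lorentzian_indicator d P f :
  M_convex P -> (forall m, P m -> mdeg m = d) ->
  (forall m, f@_m = (P m)%:R) -> denormalized_lorentzian f.
Proof.
move=> Pconv Pdeg fE; exists d; split.
  apply/dhomogP => m; rewrite mcoeff_msupp fE.
  by rewrite pnatr_eq0 eqb0 negbK; exact: Pdeg.
apply: lorentzian_indicator Pconv Pdeg _ => m.
by rewrite mcoeff_normalization fE.
Qed.

End IndicatorPolynomial.

(** * Integer base polytopes *)

Section BasePolytope.
Variables (k : nat) (g : {set 'I_k} -> nat).
Hypothesis g0 : g set0 = 0%N.
Hypothesis g_submod : forall X Y : {set 'I_k},
  (g (X :|: Y) + g (X :&: Y) <= g X + g Y)%N.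
Implicit Types (a b : 'X_{1..k}) (X Y I : {set 'I_k}).

Definition weight a I : nat := \sum_(i in I) a i.

Definition base_point a :=
  [forall I : {set 'I_k}, (weight a I <= g I)%N] && (mdeg a == g setT).

Lemma weightUI a X Y :
  (weight a (X :|: Y) + weight a (X :&: Y) = weight a X + weight a Y)%N.
Proof.
have wD Z W : (weight a Z = weight a (Z :&: W) + weight a (Z :\: W))%N.
  exact: big_setID.
have := wD (X :|: Y) X; have := wD Y X.
rewrite setUK setDUl setDv set0U (setIC Y); lia.
Qed.

Lemma weight_exchange a i j I : (0 < a i)%N ->
  (weight (a - U_(i) + U_(j))%MM I + (i \in I) = weight a I + (j \in I))%N.
Proof.
have w1 l : (\sum_(p in I) U_(l)%MM p = (l \in I))%N.
  rewrite big_mkcond (bigD1 l) //= big1 ?addn0 => [|p pl]; rewrite mnm1E.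
    by rewrite eqxx; case: (l \in I).
  by rewrite eq_sym (negPf pl) if_same.
move=> ai; rewrite -!w1 /weight -!big_split /=; apply: eq_bigr => p _.
by rewrite mnmDE mnmBE !mnm1E; case: (i =P p) => [<-|_]; lia.
Qed.

Lemma weightT a : weight a setT = mdeg a.
Proof. by rewrite mdegE; apply: eq_bigl => i; rewrite inE. Qed.

Lemma base_point_M_convex : M_convex base_point.
Proof.
move=> i a b Pa Pb lt_ba.
have /andP[/forallP leb /eqP degb] := Pb; have /andP[/forallP lea /eqP dega] := Pa.
(* X is the least b-tight set containing i and Y the largest a-tight set
   avoiding i; an index j of X \ Y with a j < b j can be exchanged with i. *)
pose X := \bigcap_(I : {set 'I_k} | (weight b I == g I) && (i \in I)) I.
pose Y := \bigcup_(I : {set 'I_k} | (weight a I == g I) && (i \notin I)) I.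
(* By submodularity, tight sets are closed under intersection and union. *)
have /andP[/eqP tightX iX] : (weight b X == g X) && (i \in X).
  apply: (big_ind (fun I => (weight b I == g I) && (i \in I))) => //.
    by rewrite weightT degb eqxx inE.
  move=> I J /andP[/eqP tI iI] /andP[/eqP tJ iJ]; rewrite inE iI iJ andbT.
  have := weightUI b I J; have := g_submod I J.
  by have := leb (I :|: J); have := leb (I :&: J); lia.
have /andP[/eqP tightY iY] : (weight a Y == g Y) && (i \notin Y).
  apply: (big_ind (fun I => (weight a I == g I) && (i \notin I))) => //.
    by rewrite /weight big_set0 g0 eqxx inE.
  move=> I J /andP[/eqP tI iI] /andP[/eqP tJ iJ]; rewrite inE negb_or iI iJ andbT.
  have := weightUI a I J; have := g_submod I J.
  by have := lea (I :|: J); have := lea (I :&: J); lia.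
(* Add the bounds of [a] on the union and of [b] on the intersection, then use submodularity and the
   tightness of [X] and [Y]. *)
have le_XY : (weight a (X :\: Y) <= weight b (X :\: Y))%N.
  have wD c : (weight c X = weight c (X :&: Y) + weight c (X :\: Y))%N.
    exact: big_setID.
  have := weightUI a X Y; have := g_submod X Y; have := wD a; have := wD b.
  by have := lea (X :|: Y); have := leb (X :&: Y); lia.
have /exists_inP[j jXY lt_ab] : [exists j in X :\: Y, (a j < b j)%N].
  apply: contraT => /exists_inPn ge_ab; move: le_XY; rewrite leqNgt => /negP; case.
  rewrite /weight (bigD1 i) ?inE ?iX ?iY //= [ltnRHS](bigD1 i) ?inE ?iX ?iY //=.
  rewrite -addSn leq_add //; apply: leq_sum => j /andP[/ge_ab + _].
  by rewrite -leqNgt.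
have [jX jY] : j \in X /\ j \notin Y by move: jXY; rewrite inE => /andP[].
have ai : (0 < a i)%N by lia.
have bj : (0 < b j)%N by lia.
(* The exchange raises the weight only of sets containing [q] but not [p], and only by one, so it
   suffices that none of these is tight. *)
have base_exchange c p q : base_point c -> (0 < c p)%N ->
    (forall I : {set 'I_k}, q \in I -> p \notin I -> weight c I != g I) ->
    base_point (c - U_(p) + U_(q))%MM.
  move=> /andP[/forallP lec /eqP degc] cp ntight; apply/andP; split.
    apply/forallP => I; have := weight_exchange q I cp; have := lec I.
    have := ntight I.
    by case: (boolP (q \in I)) => qI; case: (boolP (p \in I)) => pI /=; lia.
  have := weight_exchange q setT cp; rewrite !weightT !inE degc; lia.
exists j; split=> //; apply: base_exchange => // I.
  move=> jI iI; apply: contra jY => tI.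
  by apply/bigcupP; exists I => //; rewrite tI iI.
move=> iI jI; apply: contra jI => tI.
by move/bigcapP: jX; apply; rewrite tI iI.
Qed.

End BasePolytope.

(** * Circulations in plane digraphs *)

Section OrbitMatrix.
Variables (T : finType) (s : {perm T}).

(** The rows are the indicators of the orbits, so the row space consists of functions invariant
    under [s]. *)
Definition orbit_mx : 'M[rat]_(#|porbits s|, #|T|) :=
  \matrix_(i, j) (enum_val j \in (enum_val i : {set T}))%:R.

Lemma mem_porbits_perm (O : {set T}) x :
  O \in porbits s -> (s x \in O) = (x \in O).
Proof.
case/imsetP=> y _ ->; rewrite -!eq_porbit_mem.
by rewrite -(porbit_perm s 1 x) expg1.
Qed.

Lemma orbit_mx_invariant (u : 'rV_#|T|) x :
  (u <= orbit_mx)%MS -> u 0 (enum_rank (s x)) = u 0 (enum_rank x).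
Proof.
case/submxP=> w ->; rewrite !mxE; apply: eq_bigr => i _.
by rewrite !mxE !enum_rankK mem_porbits_perm ?enum_valP.
Qed.

(** Selecting one point from each orbit gives a right inverse. *)
Lemma rank_orbit_mx : \rank orbit_mx = #|porbits s|.
Proof.
apply/eqP; rewrite -[_ == _]/(row_free _); apply/row_freeP.
have ex_pt (i : 'I_#|porbits s|) : exists x, enum_val i == porbit s x.
  by have /imsetP[x _ ->] := enum_valP i; exists x.
pose pt i := xchoose (ex_pt i).
have ptE i : enum_val i = porbit s (pt i) by apply/eqP/(xchooseP (ex_pt i)).
exists (\matrix_(j, i) (enum_val j == pt i)%:R); apply/matrixP => i k.
rewrite !mxE (bigD1 (enum_rank (pt k))) //= big1 => [|j jk].
  rewrite !mxE enum_rankK eqxx mulr1 addr0 ptE -eq_porbit_mem -!ptE.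
  by rewrite (inj_eq enum_val_inj) eq_sym.
rewrite !mxE; case: eqP => [jE|]; last by rewrite mulr0.
by rewrite -jE enum_valK eqxx in jk.
Qed.

End OrbitMatrix.

Section PlaneCirculations.
Variables (E : finType) (rot : {perm dart E}).

Local Notation link := (dart_link rot).

(** Right multiplication sends a function on darts to the difference of its values on the two darts
    of each edge: indicators of vertices become cuts, those of faces become signed boundaries. *)
Definition incidence_mx : 'M[rat]_(#|dart E|, #|E|) :=
  \matrix_(d, e) (((enum_val d).1 == enum_val e)%:R * (-1) ^+ (~~ (enum_val d).2)).

Lemma sum_dart (f : dart E -> rat) :
  \sum_d f d = \sum_e (f (e, true) + f (e, false)).
Proof.
rewrite (eq_bigr (fun d => f (d.1, d.2))) => [|[] //].
rewrite -(pair_bigA _ (fun e b => f (e, b))) /=.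
by apply: eq_bigr => e _; rewrite big_bool.
Qed.

Lemma mul_incidence_mx (u : 'rV_#|dart E|) e :
  (u *m incidence_mx) 0 (enum_rank e) =
  u 0 (enum_rank (e, true)) - u 0 (enum_rank (e, false)).
Proof.
rewrite mxE sum_enum_rank /=.
rewrite sum_dart.
rewrite (bigD1 e) //= [X in _ + X]big1 ?addr0 => [|e' e'e].
  by rewrite !mxE !enum_rankK /= eqxx expr0 expr1 !mul1r mulr1 mulrN1.
by rewrite !mxE !enum_rankK /= (negPf e'e) !mul0r !mulr0 addr0.
Qed.

Lemma orbit_incidence_mx (s : {perm dart E}) i e :
  (orbit_mx s *m incidence_mx) i (enum_rank e) =
  ((e, true) \in (enum_val i : {set dart E}))%:R
    - ((e, false) \in (enum_val i : {set dart E}))%:R.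
Proof.
have -> : (orbit_mx s *m incidence_mx) i (enum_rank e) =
    (row i (orbit_mx s) *m incidence_mx) 0 (enum_rank e).
  by rewrite -row_mul [RHS]mxE.
by rewrite mul_incidence_mx !mxE !enum_rankK.
Qed.

Lemma dart_link_sym : connect_sym link.
Proof.
have link_rot x y : fconnect rot x y -> connect link x y.
  apply: connect_sub => {}x {}y /= /eqP <-.
  by apply: connect1; rewrite /dart_link eqxx.
apply: symmetric_from_pre => x y; move: x y.
have pre x y : link x y -> connect link y x.
  case/orP => /eqP <-; last first.
    by apply: connect1; rewrite /dart_link !permE flip_funK eqxx orbT.
  by apply: link_rot; rewrite fconnect_sym ?fconnect1 //; exact: perm_inj.
move=> x y /connectP[p]; elim: p x => [|z p IHp] x /=; first by move=> _ ->.
case/andP=> xz zp lastp; exact: connect_trans (IHp _ zp lastp) (pre _ _ xz).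
Qed.

(* The vectors of this intersection are constant on connected components. *)
Lemma rank_orbit_cap_ker (s : {perm dart E}) :
  (forall u : dart E -> rat, (forall d, u (s d) = u d) ->
     (forall d, u (flip E d) = u d) -> forall d, u (rot d) = u d) ->
  (\rank (orbit_mx s :&: kermx incidence_mx) <= n_comp link predT)%N.
Proof.
move=> s_flip_rot.
pose C : 'M[rat]_(n_comp link predT, #|dart E|) :=
  \matrix_(i, j) (fingraph.root link (enum_val j) == enum_val i)%:R.
suff /mxrankS le_C : (orbit_mx s :&: kermx incidence_mx <= C)%MS.
  exact: leq_trans le_C (rank_leq_row _).
apply/rV_subP => v; rewrite sub_capmx => /andP[v_orb /sub_kermxP v_ker].
pose u d := v 0 (enum_rank d).
have u_flip d : u (flip E d) = u d.
  have flipE (e : E) : u (e, true) = u (e, false).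
    apply/eqP; rewrite -subr_eq0 -mul_incidence_mx v_ker mxE; exact: eqxx.
  by case: d => e []; rewrite permE /flip_fun /= flipE.
have u_rot := s_flip_rot u (fun d => orbit_mx_invariant d v_orb) u_flip.
have u_root d : u (fingraph.root link d) = u d.
  have /connectP[p] := connect_root link d.
  elim: p d {2 4}d => [|d' p IHp] d0 d /=; first by move=> _ ->.
  case/andP=> dd' /IHp{}IHp /IHp ->.
  by case/orP: dd' => /eqP <-.
apply/submxP; exists (\row_i u (enum_val i)); apply/rowP => j.
have roots_j : fingraph.root link (enum_val j) \in [predI roots link & predT].
  by rewrite inE /= andbT; exact: (roots_root dart_link_sym).
rewrite !mxE (bigD1 (enum_rank_in roots_j (fingraph.root link (enum_val j)))) //=.
rewrite !mxE enum_rankK_in // eqxx mulr1 u_root /u enum_valK.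
rewrite big1 ?addr0 // => i ni; rewrite !mxE.
case: eqP => [eq_i|]; last by rewrite mulr0.
by case/eqP: ni; apply: enum_val_inj; rewrite enum_rankK_in.
Qed.

Hypothesis planar : planar_rot rot.

(* Face boundaries are orthogonal to vertex cuts, and planarity says that the
   ranks of these two spaces add up to the number of edges. *)
Lemma planar_circulation (z : E -> rat) :
  (forall d, \sum_(d' in porbit rot d) (-1) ^+ (~~ d'.2) * z d'.1 = 0) ->
  exists2 phi : dart E -> rat, (forall d, phi (face_perm rot d) = phi d)
    & forall e, z e = phi (e, true) - phi (e, false).
Proof.
move=> circ.
pose Fm := orbit_mx (face_perm rot) *m incidence_mx.
pose Vm := orbit_mx rot *m incidence_mx.
(* A function invariant under [flip] and under either [face_perm rot] or [rot] is constant on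
   components, so passing to edges costs each rank at most one per component. *)
have rankF : (#|porbits (face_perm rot)| <= \rank Fm + n_comp link predT)%N.
  rewrite -[leqLHS](rank_orbit_mx (face_perm rot)) -(mxrank_mul_ker _ incidence_mx).
  rewrite leq_add2l; apply: rank_orbit_cap_ker => u u_face u_flip d.
  have -> : rot d = face_perm rot (flip E d) by rewrite permM !permE flip_funK.
  by rewrite u_face.
have rankV : (#|porbits rot| <= \rank Vm + n_comp link predT)%N.
  rewrite -[leqLHS](rank_orbit_mx rot) -(mxrank_mul_ker _ incidence_mx).
  by rewrite leq_add2l; apply: rank_orbit_cap_ker => u u_rot _.
(* Reindexing by [face_perm rot] fixes [p] and turns [q d] into [q (flip E d)], since [q] is
   invariant under [rot]. *)
have FV : Fm *m Vm^T = 0.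
  apply/matrixP => i k; rewrite mxE sum_enum_rank /=.
  pose p d : rat := (d \in (enum_val i : {set dart E}))%:R.
  pose q d : rat := (d \in (enum_val k : {set dart E}))%:R.
  transitivity (\sum_d p d * (q d - q (flip E d))).
    rewrite sum_dart; apply: eq_bigr => e _.
    rewrite [Vm^T _ _]mxE !orbit_incidence_mx -/(p _) -/(p _) -/(q _) -/(q _).
    by rewrite !permE /flip_fun /=; ring.
  under eq_bigr => d _ do rewrite mulrBr.
  rewrite big_split /= (reindex_inj (@perm_inj _ (face_perm rot))) /= sumrN.
  rewrite mxE; apply/eqP; rewrite subr_eq0; apply/eqP; apply: eq_bigr => d _.
  rewrite /p /q mem_porbits_perm ?enum_valP //; congr (_ * _%:R).
  by rewrite permM mem_porbits_perm ?enum_valP.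
pose v : 'rV[rat]_#|E| := \row_j z (enum_val j).
have v_ker : (v <= kermx Vm^T)%MS.
  apply/sub_kermxP/rowP => k; rewrite mxE sum_enum_rank /=.
  have /imsetP[d _ kE] := enum_valP k.
  rewrite [RHS]mxE; apply: etrans (circ d).
  rewrite [RHS]big_mkcond sum_dart /=; apply: eq_bigr => e _.
  rewrite [Vm^T _ _]mxE orbit_incidence_mx mxE enum_rankK kE.
  by case: (_ \in _); case: (_ \in _) => /=; ring.
(* [Fm] lies in the kernel of [Vm^T], and planarity makes its rank at least the dimension of that
   kernel, so the two spaces agree. *)
have : (v <= Fm)%MS.
  apply: submx_trans v_ker _; have /mxrank_leqif_sup F_le := introT sub_kermxP FV.
  rewrite -(geq_leqif F_le) mxrank_ker mxrank_tr.
  by move: planar; rewrite /planar_rot; lia.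
case/submxP=> w vE; pose u := w *m orbit_mx (face_perm rot).
exists (fun d => u 0 (enum_rank d)) => [d|e].
  by apply: orbit_mx_invariant; exact: submxMl.
by rewrite -mul_incidence_mx -mulmxA -vE mxE enum_rankK.
Qed.

End PlaneCirculations.

(** * Arborescences as spanning branchings *)

Lemma connect_preserved (T : finType) (e : rel T) (P : T -> Prop) x y :
  (forall u v, e u v -> P u -> P v) -> connect e x y -> P x -> P y.
Proof.
move=> step /connectP[p]; elim: p x => [|z p IHp] x /=; first by move=> _ ->.
by case/andP=> /step xz /IHp zy y_last /xz; apply: zy.
Qed.

Section Branchings.
Variable D : alternating_dimap.
Local Notation V := (ad_vertex D).
Local Notation E := (ad_edge D).
Implicit Types (A : {set E}) (r u v : V) (p : seq E).

Definition out_adj A : rel V := fun u v =>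
  [exists e in A, (ad_tail e == u) && (ad_head e == v)].

(** Working form of an arborescence, by conditions on heads and reachability; [arborescenceE] proves
    the equivalence. *)
Definition branching A r :=
  [/\ forall e, e \in A -> ad_head e != r,
      {in A &, injective (@ad_head D)} & forall v, connect (out_adj A) r v].

Lemma out_adjP A u v :
  reflect (exists e, [/\ e \in A, ad_tail e = u & ad_head e = v]) (out_adj A u v).
Proof.
apply: (iffP exists_inP) => [[e eA /andP[/eqP eu /eqP ev]]|[e [eA eu ev]]].
  by exists e.
by exists e; rewrite ?eu ?ev ?eqxx.
Qed.

Lemma diwalk_cat u p q v :
  diwalk u (p ++ q) v =
  diwalk u p (last u (map (@ad_head D) p))
    && diwalk (last u (map (@ad_head D) p)) q v.
Proof.
elim: p u => [|e p IHp] u /=; first by rewrite eqxx.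
by rewrite IHp andbA.
Qed.

Lemma diwalk_last u p v : diwalk u p v -> v = last u (map (@ad_head D) p).
Proof. by elim: p u => [|e p IHp] u /=; [move/eqP | case/andP=> _ /IHp]. Qed.

Lemma diwalk_rcons u p e v :
  diwalk u (rcons p e) v = diwalk u p (ad_tail e) && (ad_head e == v).
Proof.
rewrite -cats1 diwalk_cat /= andbA; apply/andb_id2r => _.
apply/andP/idP => [[up /eqP ->] //|up].
by rewrite -(diwalk_last up).
Qed.

Lemma diwalk_tails u p v : diwalk u p v ->
  rcons (map (@ad_tail D) p) v = u :: map (@ad_head D) p.
Proof.
elim: p u => [|e p IHp] u /=; first by move/eqP ->.
by case/andP=> /eqP <- /IHp ->.
Qed.

Lemma closed_diwalk_und_cycle A u e p :
  all (mem A) (e :: p) -> diwalk u (e :: p) u ->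
  uniq (map (@ad_head D) (e :: p)) ->
  und_cycle A [seq (f, true) | f <- e :: p].
Proof.
move=> pA pu up; apply/and5P; split=> //.
- by rewrite all_map.
- have next_path f q w : diwalk (ad_head f) q w ->
      path (@dart_next D) (f, true) [seq (f', true) | f' <- q].
    elim: q f => [|f' q IHq] f //= /andP[/eqP eq_f /IHq ->].
    by rewrite /dart_next /dart_vertex permE /= eq_f eqxx.
  have /diwalk_last := pu; have := pu => /= /andP[/eqP eu /next_path].
  rewrite rcons_path => -> /= ulast; rewrite /dart_next /dart_vertex permE.
  rewrite (last_map (fun f => (f, true))) /= eu; apply/eqP.
  by rewrite {1}ulast last_map.
- rewrite -map_comp (eq_map (g := id)) ?map_id //; exact: map_uniq up.
- rewrite -map_comp (eq_map (g := @ad_tail D)) //.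
  have /perm_uniq : perm_eq (map (@ad_tail D) (e :: p)) (map (@ad_head D) (e :: p)).
    rewrite -(perm_cons u) -(diwalk_tails pu).
    by rewrite perm_sym perm_rcons.
  by move=> ->.
Qed.

(** If the head of [e] were already on the path, the rest of the path from there followed by [e]
    would be a directed cycle in [A]. *)
Lemma dipath_extend A r p e :
  (forall c, ~~ und_cycle A c) -> e \in A -> dipath A r p (ad_tail e) ->
  dipath A r (rcons p e) (ad_head e).
Proof.
move=> acyc eA /and3P[pA rp up]; apply/and3P; split.
- by rewrite all_rcons pA andbT.
- by rewrite diwalk_rcons rp eqxx.
rewrite map_rcons -rcons_cons rcons_uniq up andbT; apply/negP => e_in.
pose i := index (ad_head e) (r :: map (@ad_head D) p).
have i_lt : (i < (size p).+1)%N by move: e_in; rewrite -index_mem /= size_map.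
have p_split := cat_take_drop i p.
have last_i : last r (map (@ad_head D) (take i p)) = ad_head e.
  rewrite map_take; have := nth_index r e_in; rewrite -/i.
  case: (i) i_lt => [|j] jp /=; first by rewrite take0.
  rewrite -nth_last size_takel ?size_map // => <-.
  by rewrite nth_take //; apply: set_nth_default; rewrite size_map.
have walk : diwalk (ad_head e) (rcons (drop i p) e) (ad_head e).
  rewrite diwalk_rcons eqxx andbT.
  by move: rp; rewrite -{1}p_split diwalk_cat last_i => /andP[].
have all_walk : all (mem A) (rcons (drop i p) e).
  rewrite all_rcons; apply/andP; split; first exact: eA.
  by move: pA; rewrite -{1}p_split all_cat => /andP[].
have uniq_walk : uniq (map (@ad_head D) (rcons (drop i p) e)).
  rewrite map_rcons -last_i.
  move: up; rewrite -{1}p_split map_cat -cat_cons cat_uniq => /and3P[_ + u2].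
  rewrite rcons_uniq u2 andbT => /hasPn no_common; apply/negP => /no_common.
  by rewrite /= mem_last.
have := acyc.
case: (rcons _ _) walk all_walk uniq_walk (size_rcons (drop i p) e) => // f q.
move=> walk allw uw _ /(_ [seq (f', true) | f' <- f :: q])/negP; apply.
exact: closed_diwalk_und_cycle walk uw.
Qed.

(** An edge entering [r] would extend a dipath from [r] back to its start. Two edges with a common
    head extend dipaths to their tails, and by uniqueness the results share their last edge. *)
Lemma arborescence_branching A r : arborescence A r -> branching A r.
Proof.
move=> [[_ acyc] paths]; split.
- move=> e eA; have [p [rp _]] := paths (ad_tail e).
  have /and3P[_ _] := dipath_extend acyc eA rp.
  rewrite map_rcons cons_uniq mem_rcons inE negb_or eq_sym.
  by case/andP=> /andP[].
- move=> e f eA fA eq_ef.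
  have [p [rp _]] := paths (ad_tail e); have [q [rq _]] := paths (ad_tail f).
  have rpe := dipath_extend acyc eA rp; have rqf := dipath_extend acyc fA rq.
  have [s [_ s_uniq]] := paths (ad_head e).
  have := s_uniq _ rpe; rewrite eq_ef in s_uniq *; rewrite (s_uniq _ rqf).
  by move/rcons_inj => [].
- move=> v; have [p [/and3P[pA rp _] _]] := paths v.
  elim: p r pA rp {paths} => [|e p IHp] r /=; first by move=> _ /eqP ->.
  case/andP=> eA pA /andP[/eqP er /(IHp _ pA)]; apply: connect_trans.
  by apply: connect1; apply/out_adjP; exists e.
Qed.

Lemma branching_in_edge A r v : branching A r -> v != r ->
  exists2 e, e \in A & ad_head e = v.
Proof.
case=> _ _ /(_ v) /connectP[p]; case: (lastP p) => [_ -> /eqP //|q w].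
rewrite rcons_path last_rcons => /andP[_ /out_adjP[e [eA _ ew]]] -> _.
by exists e.
Qed.

(** One entering edge is chosen for each vertex other than [r]; unlike in a branching, directed
    cycles may occur. *)
Definition in_choice A r :=
  [/\ forall e, e \in A -> ad_head e != r,
      {in A &, injective (@ad_head D)}
    & forall v, v != r -> exists2 e, e \in A & ad_head e = v].

Lemma branching_in_choice A r : branching A r -> in_choice A r.
Proof.
by move=> bA; have [] := bA; split => // v; exact: branching_in_edge bA.
Qed.

Lemma card_in_choice A r : in_choice A r -> #|A| = #|V|.-1.
Proof.
case=> no_r inj_head in_edge.
rewrite -(card_in_imset inj_head) -(cardsC1 r); congr #|pred_of_set _|.
apply/setP => v; rewrite !inE; apply/imsetP/idP => [[e eA ->]|/in_edge[e eA ev]].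
  exact: no_r.
by exists e.
Qed.

(** The edges of an undirected cycle have distinct heads, so by counting every vertex of the cycle
    is entered by a cycle edge, its only entering edge in [A]. Hence no path from [r] gets onto the
    cycle, contradicting reachability. Uniqueness of dipaths follows by comparing last edges. *)
Lemma branching_arborescence A r : branching A r -> arborescence A r.
Proof.
move=> bA; have [no_r inj_head reach] := bA; split; first split.
- have und_out u v : out_adj A u v -> connect (und_adj A) u v.
    case/out_adjP=> e [eA eu ev]; apply: connect1; apply/existsP; exists (e, true).
    by rewrite eA permE /dart_vertex /= eu ev !eqxx.
  have und_in u v : out_adj A u v -> connect (und_adj A) v u.
    case/out_adjP=> e [eA eu ev]; apply: connect1; apply/existsP; exists (e, false).
    by rewrite eA permE /dart_vertex /= eu ev !eqxx.
  move=> u v; apply: (@connect_trans _ _ r); last first.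
    exact: connect_sub und_out _ _ (reach v).
  pose P x := connect (und_adj A) x r.
  apply: (connect_preserved (P := P) _ (reach u)) (connect0 _ _) => x y /und_in yx.
  exact: connect_trans.
- move=> c; apply/negP => /and5P[c_ne c_A c_next uniq_e uniq_v].
  pose es := map fst c; pose vs := map (@dart_vertex D) c.
  have end_vs d : d \in c -> dart_vertex d \in vs /\ dart_vertex (flip _ d) \in vs.
    move=> dc; split; first exact: map_f.
    by rewrite (eqP (next_cycle c_next dc)) map_f ?mem_next.
  have ends_vs e : e \in es -> ad_head e \in vs /\ ad_tail e \in vs.
    case/mapP=> -[f b] /end_vs + -> /=; rewrite permE /dart_vertex /=.
    by case: b => -[].
  have es_A e : e \in es -> e \in A by case/mapP=> d /(allP c_A) dA ->.
  have heads_uniq : uniq (map (@ad_head D) es).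
    by rewrite map_inj_in_uniq // => e f /es_A eA /es_A fA; exact: inj_head.
  have heads_vs : {subset map (@ad_head D) es <= vs}.
    by move=> v /mapP[e /ends_vs[] ? _ ->].
  have [|_ vs_heads] := uniq_min_size heads_uniq heads_vs; first by rewrite !size_map.
  have avoid v : v \notin vs.
    apply: (connect_preserved (P := fun x => x \notin vs) _ (reach v)).
      move=> x y /out_adjP[e [eA ex ey]]; apply: contra; rewrite -vs_heads.
      case/mapP=> f fes yf; rewrite -ex.
      have -> : e = f by exact: (inj_head _ _ eA (es_A _ fes) (etrans ey yf)).
      by have [] := ends_vs f fes.
    by apply/negP; rewrite -vs_heads => /mapP[e /es_A/no_r + re]; rewrite -re eqxx.
  have [d dc] : exists d, d \in c.
    by case: (c) c_ne => // d c' _; exists d; exact: mem_head.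
  by have := avoid (dart_vertex d); rewrite map_f.
- move=> v; have in_edge := branching_in_edge bA.
  have /connectP[p0] := reach v; case/shortenP => p rp up _ {p0} vlast.
  have lift_path : exists q,
      [/\ all (mem A) q, diwalk r q v & map (@ad_head D) q = p].
    elim: p {up} r rp vlast {no_r reach bA in_edge} => [|w p IHp] r /=.
      by move=> _ ->; exists [::]; rewrite /= eqxx.
    case/andP=> /out_adjP[e [eA er ew]] /IHp wp /wp [q [qA qw <-]].
    by exists (e :: q); rewrite /= er ew eqxx qA qw eA.
  have [q [qA rq qp]] := lift_path; exists q; split.
    by apply/and3P; rewrite qp.
  have uniq_path : forall q q' w, all (mem A) q -> all (mem A) q' ->
      diwalk r q w -> diwalk r q' w -> q = q'.
    elim/last_ind => [|s e IHs] q'; case/lastP: q' => [|s' e'] w //.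
    - move=> _ /[!all_rcons] /andP[/no_r e'r _] /eqP <-.
      by rewrite diwalk_rcons (negPf e'r) andbF.
    - move=> /[!all_rcons] /andP[/no_r er _] _ wp /eqP rw; move: wp.
      by rewrite -rw diwalk_rcons (negPf er) andbF.
    rewrite !all_rcons !diwalk_rcons => /andP[eA sA] /andP[e'A s'A].
    case/andP=> rs /eqP ew /andP[rs' /eqP e'w].
    have ee' : e = e' by apply: inj_head; rewrite ?ew.
    by rewrite -ee' in rs' *; rewrite (IHs _ _ sA s'A rs rs').
  by move=> q' /and3P[q'A rq' _]; exact: uniq_path rq rq'.
Qed.

Lemma arborescenceE A r : arborescence A r <-> branching A r.
Proof.
by split; [exact: arborescence_branching | exact: branching_arborescence].
Qed.

End Branchings.

(** * At most one branching per multidegree *)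

(** Linear duality: [z] is in the row space of the coboundary matrix [M] once it is orthogonal to
    the cokernel, whose columns are the functions invariant under [s]. *)
Lemma coboundary_perm (T : finType) (s : {perm T}) (z : T -> rat) :
  (forall q : T -> rat, (forall x, q (s x) = q x) -> \sum_x z x * q x = 0) ->
  exists zeta : T -> rat, forall x, z x = zeta x - zeta (s x).
Proof.
move=> orth; pose M : 'M[rat]_#|T| :=
  \matrix_(i, j) ((i == j)%:R - (enum_val i == s (enum_val j))%:R).
pose zr : 'rV[rat]_#|T| := \row_j z (enum_val j).
suff /submxP[w zE] : (zr <= M)%MS.
  exists (fun x => w 0 (enum_rank x)) => x.
  have /rowP/(_ (enum_rank x)) := zE; rewrite !mxE enum_rankK => ->.
  under eq_bigr => i _ do rewrite mxE mulrBr.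
  rewrite big_split /= sumrN (bigD1 (enum_rank x)) //= eqxx mulr1.
  rewrite big1 ?addr0 => [|i /negPf ->]; last by rewrite mulr0.
  rewrite (bigD1 (enum_rank (s x))) //= !enum_rankK eqxx mulr1.
  rewrite big1 ?addr0 // => i ix; case: eqP => [iE|]; last by rewrite mulr0.
  by rewrite -iE enum_valK eqxx in ix.
rewrite submxE; apply/eqP/rowP => k; rewrite [RHS]mxE mxE sum_enum_rank /=.
pose q x := cokermx M (enum_rank x) k.
rewrite -[RHS](orth q) => [|x].
  by apply: eq_bigr => x _; rewrite mxE enum_rankK.
have := mulmx_coker M => /matrixP/(_ (enum_rank (s x)) k).
rewrite mxE [RHS]mxE sum_enum_rank /=.
under eq_bigr => y _ do rewrite mxE !enum_rankK mulrBl.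
rewrite big_split /= sumrN (bigD1 (s x)) //= eqxx mul1r.
rewrite big1 ?addr0 => [|y yx]; last first.
  by rewrite (inj_eq enum_rank_inj) eq_sym (negPf yx) mul0r.
rewrite (bigD1 x) //= eqxx mul1r big1 ?addr0 => [|y yx].
  by move/eqP; rewrite subr_eq0 => /eqP.
by rewrite (inj_eq perm_inj) eq_sym (negPf yx) mul0r.
Qed.

Section DimapStructure.
Variable D : alternating_dimap.
Local Notation V := (ad_vertex D).
Local Notation E := (ad_edge D).
Local Notation rot := (ad_rot D).

(** Turning once at the head of [e] gives the edge after [e] on the region to its right; turning
    once at the tail ([prev_ccw]) gives the edge before [e] on the region to its left. *)
Definition next_cw_fun (e : E) : E := (rot (e, false)).1.
Definition prev_ccw (e : E) : E := (rot (e, true)).1.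

Lemma rot_head e : rot (e, false) = (next_cw_fun e, true).
Proof. by rewrite [LHS]surjective_pairing ad_alternating. Qed.

Lemma rot_tail e : rot (e, true) = (prev_ccw e, false).
Proof. by rewrite [LHS]surjective_pairing ad_alternating. Qed.

Lemma next_cw_inj : injective next_cw_fun.
Proof.
by move=> e f eq_ef; have := rot_head e; rewrite eq_ef -rot_head => /perm_inj[].
Qed.

Definition next_cw : {perm E} := perm next_cw_inj.

Lemma tail_next_cw e : ad_tail (next_cw e) = ad_head e.
Proof.
have := ad_rot_vertex (e, false) (next_cw e, true).
by have := mem_porbit rot 1 (e, false); rewrite expg1 rot_head permE => -> /eqP.
Qed.

Lemma head_prev_ccw e : ad_head (prev_ccw e) = ad_tail e.
Proof.
have := ad_rot_vertex (e, true) (prev_ccw e, false).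
by have := mem_porbit rot 1 (e, true); rewrite expg1 rot_tail => -> /eqP.
Qed.

Lemma face_cw e : face_perm rot (e, true) = (next_cw e, true).
Proof. by rewrite permM !permE /flip_fun /= rot_head. Qed.

Lemma face_ccw e : face_perm rot (e, false) = (prev_ccw e, false).
Proof. by rewrite permM [flip _ _]permE /flip_fun /= rot_tail. Qed.

(** Two turns of [rot] lead from an entering edge to the next entering edge; an odd number of turns
    ends at a leaving one. *)
Lemma head_rotation (e f : E) : ad_head e = ad_head f ->
  exists i, iter i (prev_ccw \o next_cw) e = f.
Proof.
move=> eq_ef; have := ad_rot_vertex (e, false) (f, false).
rewrite /= eq_ef eqxx => /esym/porbitP[i fE].
have rot_even j :
    (rot ^+ j.*2)%g (e, false) = (iter j (prev_ccw \o next_cw) e, false).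
  elim: j => [|j IHj]; first by rewrite expg0 perm1.
  by rewrite doubleS !expgSr !permM IHj rot_head rot_tail /= permE.
have := odd_double_half i; case: (odd i) => iE; rewrite -iE in fE.
  by move: fE; rewrite expgSr permM rot_even rot_head.
by exists i./2; move: fE; rewrite rot_even => -[].
Qed.

Lemma val_region_index (e : E) : enum_val (region_index e) = cw_region_of e.
Proof. by rewrite /region_index enum_rankK_in // cw_region_ofP. Qed.

Lemma region_index_next_cw (e : E) : region_index (next_cw e) = region_index e.
Proof.
apply: enum_val_inj; rewrite !val_region_index.
by have := porbit_perm (face_perm rot) 1 (e, true); rewrite expg1 face_cw.
Qed.

Lemma region_index_eq (e f : E) : region_index e = region_index f ->
  exists i, iter i next_cw e = f.
Proof.
move/(congr1 enum_val); rewrite !val_region_index => /eqP.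
rewrite eq_porbit_mem porbit_sym => /porbitP[i fE]; exists i; move: fE.
have -> : (face_perm rot ^+ i)%g (e, true) = (iter i next_cw e, true).
  by elim: i => [|i IHi]; [rewrite expg0 perm1 | rewrite expgSr permM IHi face_cw].
by case.
Qed.

Lemma region_index_surj i : exists e : E, region_index e = i.
Proof.
have := enum_valP i; rewrite inE => /andP[/imsetP[[e b] _ iE] /forall_inP cw].
have := cw (e, b); rewrite iE porbit_id => /(_ isT) /= bT; exists e.
by apply: enum_val_inj; rewrite val_region_index iE bT.
Qed.

(* As z sums to zero over regions, z = zeta - zeta o next_cw; as it sums to zero
   around vertices, zeta is a circulation, hence a combination of face
   boundaries, of which only the counterclockwise part contributes to z. *)
Lemma region_potential (z : E -> rat) :
  (forall v, \sum_(e | ad_head e == v) z e = 0) ->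
  (forall i, \sum_(e | region_index e == i) z e = 0) ->
  exists2 c : E -> rat, forall e, c (prev_ccw e) = c e
    & forall e, z e = c e - c (next_cw e).
Proof.
move=> z_head z_region.
have [zeta zE] : exists zeta : E -> rat,
    forall e, z e = zeta e - zeta (next_cw e).
  apply: coboundary_perm => q q_next.
  rewrite (partition_big (@region_index D) predT) //=; apply: big1 => i _.
  have [e0 e0i] := region_index_surj i.
  rewrite (eq_bigr (fun e => z e * q e0)) => [|e /eqP ei].
    by rewrite -mulr_suml z_region mul0r.
  have [j <-] : exists j, iter j next_cw e0 = e by apply: region_index_eq; rewrite ei.
  by congr (_ * _); elim: j => //= j <-; rewrite q_next.
have [|phi phi_face zetaE] := planar_circulation (ad_planar D) (z := zeta).
  case=> e0 b; set v := dart_vertex (e0, b).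
  have memE d : (d \in porbit rot (e0, b)) = (dart_vertex d == v).
    by rewrite -ad_rot_vertex eq_sym.
  rewrite big_mkcond sum_dart /= big_split /= -!big_mkcond /=.
  rewrite (eq_bigl (fun e => ad_tail e == v)) => [|e]; last by rewrite memE.
  rewrite [X in _ + X](eq_bigl (fun e => ad_head e == v)) => [|e]; last first.
    by rewrite memE.
  (* The edges leaving [v] are the [next_cw] images of those entering it, so the net outflow of
     [zeta] is minus the sum of [z] over entering edges. *)
  rewrite (reindex_inj (@perm_inj _ next_cw)) /=.
  under eq_bigl => e do rewrite tail_next_cw.
  under eq_bigr => e _ do rewrite expr0 mul1r.
  under [X in _ + X]eq_bigr => e _ do rewrite expr1 mulN1r.
  transitivity (- \sum_(e | ad_head e == v) z e); last by rewrite z_head oppr0.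
  rewrite -big_split /= -sumrN; apply: eq_bigr => e _.
  by rewrite zE opprB.
(* The values [phi (e, true)] are constant along clockwise regions and cancel in [z]. *)
exists (fun e => - phi (e, false)) => e; first by rewrite -face_ccw phi_face.
by rewrite zE !zetaE -face_cw phi_face; ring.
Qed.

Lemma branching_sum_head A (r v : V) : branching A r ->
  \sum_(e | ad_head e == v) (e \in A)%:R = (v != r)%:R :> rat.
Proof.
move=> bA; have [no_r inj_head _] := bA.
have [->|vr] := eqVneq v r.
  apply: big1 => e /eqP er; have := no_r e; case: (e \in A) => // /(_ isT).
  by rewrite er eqxx.
have [a aA av] := branching_in_edge bA vr.
rewrite (bigD1 a) ?av //= aA big1 ?addr0 // => e /andP[/eqP ev ea].
case: (boolP (e \in A)) => // eA.
by rewrite (inj_head e a) ?eqxx ?ev ?av // in ea.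
Qed.

(** A maximum principle: the bound spreads along each edge [a] of [A]. It passes from the edges
    entering the tail to [a] through [prev_ccw]; any other edge entering the head of [a] rotates to
    [a] without [c] decreasing. *)
Lemma branching_potential_le A r (c : E -> rat) (M : rat) : branching A r ->
  (forall e, c (prev_ccw e) = c e) ->
  (forall e, e \notin A -> c e <= c (next_cw e)) ->
  (forall e, ad_head e = r -> c e <= M) -> forall e, c e <= M.
Proof.
move=> [no_r inj_head reach] c_ccw c_cw c_root e0.
pose P v := forall e, ad_head e = v -> c e <= M.
apply: (connect_preserved (P := P) _ (reach (ad_head e0))) (erefl) => // u v.
case/out_adjP=> a [aA au av] leu e ev.
have le_a : c a <= M by rewrite -c_ccw; apply: leu; rewrite head_prev_ccw.
have [|i] := head_rotation (e := e) (f := a); first by rewrite ev.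
elim: i e ev => [|i IHi] e ev; first by move=> /= ->.
rewrite iterSr => e_iter.
have [eA|/c_cw e_le] := boolP (e \in A).
  by rewrite (inj_head e a) // ev.
rewrite (le_trans e_le) // -c_ccw; apply: IHi e_iter.
by rewrite /= head_prev_ccw tail_next_cw.
Qed.

Lemma branching_unique A B (r : V) : branching A r -> branching B r ->
  (forall i, #|[set e in A | region_index e == i]|
     = #|[set e in B | region_index e == i]|) -> A = B.
Proof.
move=> bA bB eq_deg; pose z e : rat := (e \in A)%:R - (e \in B)%:R.
have [|i|c c_ccw zE] := region_potential (z := z).
- move=> v; rewrite big_split /= sumrN.
  by rewrite !(branching_sum_head _ bA, branching_sum_head _ bB) subrr.
- rewrite big_split /= sumrN.
  have sumE (S : {set E}) : \sum_(e | region_index e == i) (e \in S)%:R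
      = #|[set e in S | region_index e == i]|%:R :> rat.
    transitivity (\sum_(e in [set e in S | region_index e == i]) 1%:R : rat).
      rewrite [LHS]big_mkcond [RHS]big_mkcond; apply: eq_bigr => e _.
      by rewrite inE andbC; case: (_ == i); case: (e \in S).
    by rewrite -natr_sum sum1_card.
  by rewrite !sumE eq_deg subrr.
have [noA _ _] := bA; have [noB _ _] := bB.
have z_root e : ad_head e = r -> c e = c (next_cw e).
  move=> er; apply/eqP; rewrite -subr_eq0 -zE /z.
  have -> : e \in A = false by apply/negP => /noA; rewrite er eqxx.
  have -> : e \in B = false by apply/negP => /noB; rewrite er eqxx.
  by rewrite subrr.
(* No edge of either branching enters [r], so [c] does not change under rotation about [r]. *)
have [M rootM] : exists M, forall e, ad_head e = r -> c e = M.
  have [e0 e0r|no_e] := pickP (fun e => ad_head e == r); last first.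
    by exists 0 => e er; have := no_e e; rewrite /= er eqxx.
  exists (c e0) => e er; have [|i <-] := head_rotation (e := e) (f := e0).
    by rewrite er (eqP e0r).
  elim: i e er => // i IHi e er; rewrite iterSr.
  by rewrite z_root // -c_ccw IHi //= head_prev_ccw tail_next_cw.
(* Outside [A] one has [z <= 0], which bounds [c] above; outside [B] one has [z >= 0], which bounds
   [- c] above. *)
have cE e : c e = M.
  apply/eqP; rewrite eq_le; apply/andP; split.
    apply: (branching_potential_le bA) e => // [e eA|e er]; last by rewrite rootM.
    by rewrite -subr_le0 -zE /z (negPf eA) sub0r oppr_le0 ler0n.
  rewrite -[c e]opprK lerNr.
  apply: (branching_potential_le (c := fun e => - c e) bB) e => [e|e eB|e er].
  - by rewrite c_ccw.
  - by rewrite lerN2 -subr_ge0 -zE /z (negPf eB) subr0 ler0n.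
  - by rewrite rootM.
apply/setP => e; have /eqP := zE e; rewrite !cE subrr /z.
by case: (e \in A); case: (e \in B).
Qed.

End DimapStructure.

(** * The rank function of the clockwise regions *)

Lemma rank_sum_rows (F : fieldType) n (I : finType) (S : {set I})
    (w : I -> 'rV[F]_n) :
  (\rank (\sum_(i in S) <<w i>>)%MS <= #|S|)%N.
Proof.
rewrite -sum1_card; elim/big_rec2: _ => [|i k M _ leM]; first by rewrite mxrank0.
apply: leq_trans (mxrank_adds_leqif _ _) _.
by rewrite leq_add // mxrank_gen rank_leq_row.
Qed.

Section EdgeSpan.
Variable D : alternating_dimap.
Local Notation V := (ad_vertex D).
Local Notation E := (ad_edge D).
Implicit Types (S A : {set E}) (N : {set V}) (I : {set 'I_#|cw_regions D|}).

Definition vertex_vec (v : V) : 'rV[rat]_#|V| := delta_mx 0 (enum_rank v).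

Definition edge_vec (e : E) : 'rV[rat]_#|V| :=
  vertex_vec (ad_head e) - vertex_vec (ad_tail e).

Definition edge_span S : 'M[rat]_#|V| := (\sum_(e in S) <<edge_vec e>>)%MS.

Definition region_edges I : {set E} := [set e | region_index e \in I].

(** The vectors [edge_vec] represent the graphic matroid over the rationals, so this is a matroid
    rank. *)
Definition region_rank I : nat := \rank (edge_span (region_edges I)).

Lemma edge_vec_span S e : e \in S -> (edge_vec e <= edge_span S)%MS.
Proof.
move=> eS; apply: submx_trans (sumsmx_sup e eS (submx_refl _)).
by rewrite genmxE.
Qed.

Lemma edge_span_sub S n (M : 'M[rat]_(n, #|V|)) :
  (forall e, e \in S -> (edge_vec e <= M)%MS) -> (edge_span S <= M)%MS.
Proof. by move=> sub; apply/sumsmx_subP => e eS; rewrite genmxE sub. Qed.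

Lemma rank_edge_span_le S : (\rank (edge_span S) <= #|S|)%N.
Proof. exact: rank_sum_rows. Qed.

Lemma region_rank_submod I J :
  (region_rank (I :|: J) + region_rank (I :&: J) <= region_rank I + region_rank J)%N.
Proof.
rewrite /region_rank -[leqRHS]mxrank_sum_cap; apply: leq_add; apply: mxrankS.
  apply: edge_span_sub => e; rewrite !inE => /orP[] eI.
    by apply: submx_trans (addsmxSl _ _); rewrite edge_vec_span ?inE.
  by apply: submx_trans (addsmxSr _ _); rewrite edge_vec_span ?inE.
apply: edge_span_sub => e; rewrite !inE => /andP[eI eJ].
by rewrite sub_capmx !edge_vec_span ?inE.
Qed.

Lemma region_rank0 : region_rank set0 = 0%N.
Proof.
apply/eqP; rewrite -leqn0; apply: leq_trans (rank_edge_span_le _) _.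
by rewrite leqn0 cards_eq0; apply/eqP/setP => e; rewrite !inE.
Qed.

(** The edge vectors lie in the span of the vertex vectors of [N] and have coordinate sum zero, a
    proper subspace since [N] is nonempty. *)
Lemma rank_edge_span_lt S N : N != set0 ->
  (forall e, e \in S -> (ad_head e \in N) && (ad_tail e \in N)) ->
  (\rank (edge_span S) < #|N|)%N.
Proof.
case/set0Pn=> v0 v0N S_N; pose U := (\sum_(v in N) <<vertex_vec v>>)%MS.
pose ones : 'cV[rat]_#|V| := const_mx 1.
have vec_ones v : vertex_vec v *m ones = 1%:M.
  apply/matrixP => i j; rewrite !ord1 !mxE (bigD1 (enum_rank v)) //= big1 => [|k kv].
    by rewrite !mxE !eqxx mulr1 addr0.
  by rewrite !mxE (negPf kv) andbF mul0r.
have vecU v : v \in N -> (vertex_vec v <= U)%MS.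
  by move=> vN; rewrite (submx_trans _ (sumsmx_sup v vN (submx_refl _))) ?genmxE.
have span_cap : (edge_span S <= U :&: kermx ones)%MS.
  apply: edge_span_sub => e /S_N/andP[hN tN]; rewrite sub_capmx; apply/andP; split.
    by rewrite addmx_sub ?eqmx_opp ?vecU.
  by apply/sub_kermxP; rewrite mulmxBl !vec_ones subrr.
have rankU1 : (0 < \rank (U *m ones))%N.
  rewrite lt0n mxrank_eq0; apply/eqP => U0.
  have : (vertex_vec v0 *m ones <= U *m ones)%MS by rewrite submxMr ?vecU.
  rewrite U0 vec_ones => /submxP[w]; rewrite mulmx0 => /matrixP/(_ 0 0)/eqP.
  by rewrite !mxE oner_eq0.
have := mxrankS span_cap; have := rank_sum_rows N vertex_vec.
have := mxrank_mul_ker U ones; rewrite -/U; lia.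
Qed.

Lemma region_rank_lt I : I != set0 ->
  (region_rank I < #|[set ad_head e | e in region_edges I]|)%N.
Proof.
case/set0Pn=> i iI; have [e0 e0i] := region_index_surj i.
apply: rank_edge_span_lt => [|e eI].
  by apply/set0Pn; exists (ad_head e0); rewrite imset_f // inE e0i.
(* The tail of [e] is also a head on the same region, that of the preceding edge [f]. *)
rewrite imset_f //=; pose f := ((next_cw D)^-1)%g e.
have eE : e = next_cw D f by rewrite permKV.
rewrite eE tail_next_cw imset_f // inE.
by move: eI; rewrite eE inE region_index_next_cw.
Qed.

(** By reachability, the vector of [r] and the edge vectors of [A] span all vertex vectors. *)
Lemma branching_span A (r : V) : branching A r ->
  (#|V| <= (\rank (edge_span A)).+1)%N.
Proof.
case=> _ _ reach.
have full : (1%:M <= vertex_vec r + edge_span A)%MS.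
  apply/row_subP => k; rewrite rowE mulmx1 -[k]enum_valK.
  move: (enum_val k) => v.
  pose P w := (vertex_vec w <= vertex_vec r + edge_span A)%MS.
  apply: (connect_preserved (P := P) _ (reach v)).
    move=> u w /out_adjP[e [eA <- <-]] le_u.
    rewrite /P -[vertex_vec (ad_head e)](subrK (vertex_vec (ad_tail e))) addmx_sub //.
    by apply: submx_trans (addsmxSr _ _); exact: edge_vec_span.
  exact: addsmxSl.
have := mxrankS full; rewrite mxrank1 => /leq_trans; apply.
apply: leq_trans (mxrank_adds_leqif _ _) _.
by rewrite -[leqRHS]add1n leq_add // rank_leq_row.
Qed.

(** [A] has only [#|V| - 1] edges and spans at least that rank, so its edge vectors are
    independent. *)
Lemma branching_independent A (r : V) I : branching A r ->
  (#|A :&: region_edges I| <= region_rank I)%N.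
Proof.
move=> bA; have spanA := branching_span bA.
have cardA := card_in_choice (branching_in_choice bA).
have V_gt0 : (0 < #|V|)%N by apply/card_gt0P; exists r.
have le_span : (edge_span A <= edge_span (A :&: region_edges I)
    + edge_span (A :\: region_edges I))%MS.
  apply: edge_span_sub => e eA; have [eI|eI] := boolP (e \in region_edges I).
    by apply: submx_trans (addsmxSl _ _); rewrite edge_vec_span // in_setI eA.
  by apply: submx_trans (addsmxSr _ _); rewrite edge_vec_span // in_setD eI.
have le_rank : (\rank (edge_span (A :&: region_edges I)) <= region_rank I)%N.
  apply: mxrankS; apply: edge_span_sub => e; rewrite in_setI => /andP[_].
  exact: edge_vec_span.
have := mxrankS le_span.
have := mxrank_adds_leqif (edge_span (A :&: region_edges I))
  (edge_span (A :\: region_edges I)).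
move=> [+ _]; have := rank_edge_span_le (A :\: region_edges I).
have := cardsID (region_edges I) A; lia.
Qed.

Lemma region_rank_max I (r : V) : (region_rank I < #|V|)%N.
Proof.
rewrite -cardsT; apply: rank_edge_span_lt; first by apply/set0Pn; exists r.
by move=> e _; rewrite !inE.
Qed.

End EdgeSpan.

(** * Cycle popping *)

Section CyclePopping.
Variable D : alternating_dimap.
Local Notation V := (ad_vertex D).
Local Notation E := (ad_edge D).
Implicit Types (A Z : {set E}) (r v : V) (I : {set 'I_#|cw_regions D|}).

Definition multidegree A : 'X_{1..#|cw_regions D|} :=
  (\sum_(e in A) U_(region_index e))%MM.

Lemma multidegreeE A i :
  multidegree A i = (\sum_(e | region_index e == i) (e \in A))%N.
Proof.
rewrite mnm_sumE [LHS]big_mkcond [RHS]big_mkcond; apply: eq_bigr => e _.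
by rewrite mnm1E; case: (e \in A); case: (_ == i).
Qed.

Lemma weight_multidegree A I :
  weight (multidegree A) I = #|A :&: region_edges I|.
Proof.
rewrite /weight -[RHS]sum1_card.
rewrite (eq_bigr (fun i => \sum_(e | region_index e == i) (e \in A)))%N.
  rewrite (exchange_big_dep predT) //= [RHS]big_mkcond; apply: eq_bigr => e _.
  rewrite !inE; case: (boolP (region_index e \in I)) => eI /=.
    rewrite (bigD1 (region_index e)) ?eI ?eqxx //= big1 ?addn0 ?andbT.
      by case: (e \in A).
    by move=> i /andP[/andP[_ /eqP ->]]; rewrite eqxx.
  by rewrite andbF big1 // => i /andP[iI /eqP ei]; rewrite -ei (negPf eI) in iI.
by move=> i _; exact: multidegreeE.
Qed.

Lemma mdeg_multidegree A : mdeg (multidegree A) = #|A|.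
Proof.
rewrite -weightT weight_multidegree; congr #|pred_of_set _|.
by apply/setP => e; rewrite !inE andbT.
Qed.

(* Z is a nonempty vertex-disjoint union of directed cycles. *)
Definition cycle_set A Z :=
  [&& Z \subset A, Z != set0, #|(@ad_tail D) @: Z| == #|Z|
    & (@ad_head D) @: Z == (@ad_tail D) @: Z].

(** The unreached vertices avoid [r] and are closed under passing from the head to the tail of a
    chosen edge. In a minimal nonempty such set, heads and tails of the chosen edges entering it
    both exhaust it. *)
Lemma cycle_set_exists A r : in_choice A r -> ~ branching A r ->
  exists Z, cycle_set A Z.
Proof.
case=> no_r inj_head in_edge not_b.
have [v0 v0r] : exists v, ~~ connect (out_adj A) r v.
  apply/existsP; rewrite -negb_forall; apply/negP => /forallP reach.
  by apply: not_b; split.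
pose closed_set (C : {set V}) := [&& C != set0, r \notin C
  & [forall e in A, (ad_head e \in C) ==> (ad_tail e \in C)]].
pose U := [set v | ~~ connect (out_adj A) r v].
have closedU : closed_set U.
  apply/and3P; split; first by apply/set0Pn; exists v0; rewrite inE.
    by rewrite inE connect0.
  apply/forall_inP => e eA; apply/implyP; rewrite !inE; apply: contra => re.
  by apply: connect_trans re (connect1 _); apply/out_adjP; exists e.
have [C /minsetP[/and3P[C0 rC /forall_inP closedC] minC] _] := minset_exists closedU.
pose Z := [set e in A | ad_head e \in C].
have headZ : (@ad_head D) @: Z = C.
  apply/setP => v; apply/imsetP/idP => [[e]|vC].
    by rewrite inE => /andP[_ eC] ->.
  have [|e eA ev] := in_edge v; first by apply: contraNneq rC => <-.
  by exists e; rewrite ?inE ?eA ?ev.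
have tailC : (@ad_tail D) @: Z \subset C.
  apply/subsetP => v /imsetP[e]; rewrite inE => /andP[eA eC] ->.
  exact: (implyP (closedC e eA)).
have tailZ : (@ad_tail D) @: Z = C.
  apply: minC => //; apply/and3P; split.
  - case/set0Pn: C0 => v; rewrite -headZ => /imsetP[e eZ _].
    by apply/set0Pn; exists (ad_tail e); exact: imset_f.
  - by apply: contra rC; exact: (subsetP tailC).
  - apply/forall_inP => e eA; apply/implyP => /(subsetP tailC) eC.
    by rewrite imset_f // inE eA.
exists Z; apply/and4P; split.
- by apply/subsetP => e; rewrite inE => /andP[].
- by apply: contraNneq C0 => Z0; rewrite -headZ Z0 imset0.
- rewrite tailZ -{1}headZ card_in_imset // => e f.
  by rewrite !inE => /andP[eA _] /andP[fA _]; exact: inj_head.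
- by rewrite headZ tailZ.
Qed.

(* Each edge of Z is replaced by its predecessor on the same region; this keeps
   the set of heads, since Z has as many edges leaving a vertex as entering. *)
Definition pop A Z := (A :\: Z) :|: [set e | next_cw D e \in Z].

Section Pop.
Variables (A Z : {set E}) (r : V).
Hypotheses (cA : in_choice A r) (cZ : cycle_set A Z).

Lemma head_cycle_set f : f \in Z ->
  exists2 e, e \in Z & ad_head e = ad_tail f.
Proof.
case/and4P: cZ => _ _ _ /eqP eqZ fZ.
have := imset_f (@ad_tail D) fZ; rewrite -eqZ => /imsetP[e eZ fe].
by exists e.
Qed.

Lemma tail_cycle_set e : e \in Z ->
  exists2 f, f \in Z & ad_tail f = ad_head e.
Proof.
case/and4P: cZ => _ _ _ /eqP eqZ eZ.
have := imset_f (@ad_head D) eZ; rewrite eqZ => /imsetP[f fZ fe].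
by exists f.
Qed.

Lemma popped_in e : next_cw D e \in Z -> e \in A -> e \in Z.
Proof.
move=> eZ eA; have [_ inj_head _] := cA; have [/subsetP ZA _ _ _] := and4P cZ.
have [f fZ fe] := head_cycle_set eZ; rewrite tail_next_cw in fe.
by rewrite (inj_head e f eA (ZA _ fZ) (esym fe)).
Qed.

(** The union defining [pop] is disjoint: a predecessor of an edge of [Z] enters the head of some
    edge of [Z], so if chosen it is in [Z]. *)
Lemma pop_indicator e :
  ((e \in pop A Z) + (e \in Z) = (e \in A) + (next_cw D e \in Z))%N.
Proof.
have [/subsetP ZA _ _ _] := and4P cZ; rewrite !inE.
have [eZ|eZ] := boolP (e \in Z); first by rewrite ZA // addnC.
have [nZ|nZ] := boolP (next_cw D e \in Z); last by rewrite orbF.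
by have /negPf -> : e \notin A by apply: contra eZ; exact: popped_in.
Qed.

Lemma multidegree_pop : multidegree (pop A Z) = multidegree A.
Proof.
apply/mnmP => i; rewrite !multidegreeE; apply/eqP.
rewrite -(eqn_add2r (\sum_(e | region_index e == i) (e \in Z))%N) -big_split /=.
under eq_bigr => e _ do rewrite pop_indicator.
rewrite big_split /= eqn_add2l.
rewrite [X in _ == X](reindex_inj (@perm_inj _ (next_cw D))) /=.
by under [X in _ == X]eq_bigl => e do rewrite region_index_next_cw.
Qed.

Lemma in_choice_pop : in_choice (pop A Z) r.
Proof.
have [no_r inj_head in_edge] := cA; have [/subsetP ZA _ cardZ _] := and4P cZ.
have inj_tail : {in Z &, injective (@ad_tail D)} by apply/imset_injP.
have not_both e f : e \in A :\: Z -> next_cw D f \in Z -> ad_head e != ad_head f.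
  rewrite inE => /andP[eZ eA] fZ; apply: contra eZ => /eqP ef.
  have [g gZ gf] := head_cycle_set fZ; rewrite tail_next_cw in gf.
  by rewrite (inj_head e g eA (ZA _ gZ) (etrans ef (esym gf))).
split.
- move=> e; rewrite inE => /orP[|]; first by rewrite inE => /andP[_]; exact: no_r.
  rewrite inE => /head_cycle_set[g gZ ge]; rewrite tail_next_cw in ge.
  by rewrite -ge no_r ?ZA.
- move=> e f; rewrite ![_ \in pop A Z]inE => /orP[eA|eZ] /orP[fA|fZ] eq_ef.
  + by move: eA fA; rewrite !inE => /andP[_ eA] /andP[_ fA]; exact: inj_head.
  + by have := not_both e f eA; rewrite inE in fZ; rewrite eq_ef eqxx => /(_ fZ).
  + by have := not_both f e fA; rewrite inE in eZ; rewrite eq_ef eqxx => /(_ eZ).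
  + rewrite !inE in eZ fZ; apply: (@perm_inj _ (next_cw D)).
    by apply: inj_tail; rewrite ?tail_next_cw.
- move=> v /in_edge[e eA ev]; have [eZ|eZ] := boolP (e \in Z); last first.
    by exists e; rewrite // !inE eZ eA.
  have [f fZ fe] := tail_cycle_set eZ; exists ((next_cw D)^-1%g f).
    by rewrite !inE permKV fZ orbT.
  by rewrite -tail_next_cw permKV fe.
Qed.

End Pop.

Lemma choice_branching A r : in_choice A r ->
  (forall I, I != set0 ->
     (weight (multidegree A) I < #|[set ad_head e | e in region_edges I]|)%N) ->
  exists2 B, branching B r & multidegree B = multidegree A.
Proof.
move=> cA draconian; apply: contrapT => no_branching.
(* The default [set0] is never reached: no choice with this multidegree is a branching, so each has
   a cycle set. *)
pose step B := pop B (odflt set0 [pick Z | cycle_set B Z]).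
pose good B := in_choice B r /\ multidegree B = multidegree A.
have cyc_step B : good B -> exists2 Z, cycle_set B Z & step B = pop B Z.
  case=> cB degB; rewrite /step; case: pickP => [Z cZ|no_Z]; first by exists Z.
  have [|Z cZ] := cycle_set_exists cB; last by have := no_Z Z; rewrite cZ.
  by move=> bB; apply: no_branching; exists B.
have good_step B : good B -> good (step B).
  move=> gB; have [Z cZ ->] := cyc_step B gB; have [cB degB] := gB.
  by split; [exact: in_choice_pop cZ | rewrite (multidegree_pop cB cZ)].
have good_iter t : good (iter t step A) by elim: t => // t /good_step.
have [s [p p_gt0 period]] : exists s, exists2 p, (0 < p)%N &
    iter p step (iter s step A) = iter s step A.
  have /trajectP[s s_lt eq_s] := looping_order step A.
  exists s, (fingraph.order step A - s)%N; first by rewrite subn_gt0.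
  by rewrite -iterD subnK ?eq_s // ltnW.
set B := iter s step A in period.
have gB u : good (iter u step B) by rewrite /B -iterD.
have /choice[Zs cZs] : forall u, exists Z, cycle_set (iter u step B) Z /\
    iter u.+1 step B = pop (iter u step B) Z.
  by move=> u; have [Z cZ eqZ] := cyc_step _ (gB u); exists Z; rewrite iterS.
(* zeta e is the number of times e is popped during a period of the orbit of
   step; it turns out to be constant along the boundary of each region. *)
pose zeta e := (\sum_(0 <= u < p) (e \in Zs u))%N.
(* Summing [pop_indicator] over time; over a full period the membership terms cancel. *)
have telescope m e : ((e \in iter m step B) + \sum_(0 <= u < m) (e \in Zs u)
    = (e \in B) + \sum_(0 <= u < m) (next_cw D e \in Zs u))%N.
  elim: m => [|m IHm]; first by rewrite !big_nil.
  have [cZ eqZ] := cZs m; have := pop_indicator (gB m).1 cZ e.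
  rewrite eqZ !big_nat_recr //=; lia.
have zeta_next e : zeta (next_cw D e) = zeta e.
  by have := telescope p e; rewrite period -/(zeta e) -/(zeta _); lia.
pose I := [set i | [exists e, (region_index e == i) && (0 < zeta e)%N]].
have zetaI e : (region_index e \in I) = (0 < zeta e)%N.
  rewrite inE; apply/existsP/idP => [[f /andP[/eqP fe zf]]|ze]; last first.
    by exists e; rewrite eqxx.
  have [j <-] := region_index_eq fe.
  by elim: j => //= j IHj; rewrite zeta_next.
clearbody I.
have Zs_I u e : (u < p)%N -> e \in Zs u -> region_index e \in I.
  move=> up eZ; rewrite zetaI /zeta (bigD1_seq u) ?mem_index_iota ?iota_uniq //=.
  by rewrite eZ.
have I_ne : I != set0.
  have [/and4P[_ /set0Pn[e eZ] _ _] _] := cZs 0%N.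
  by apply/set0Pn; exists (region_index e); exact: Zs_I eZ.
(* At time [u] the vertex [v] is entered by a chosen edge on a region of [I]. Once true this
   persists through the period, and every head on [I] is popped at some time, so finally the weight
   of [I] is at least the number of these heads. *)
pose served u v := exists2 f, f \in iter u step B :&: region_edges I & ad_head f = v.
have served_pop u e : (u < p)%N -> e \in Zs u -> served u.+1 (ad_head e).
  move=> up eZ; have [cZ eqZ] := cZs u.
  have [f fZ fe] := tail_cycle_set cZ eZ.
  exists ((next_cw D)^-1%g f); last by rewrite -tail_next_cw permKV fe.
  rewrite eqZ inE; apply/andP; split; first by rewrite !inE permKV fZ orbT.
  by rewrite inE -region_index_next_cw permKV; exact: Zs_I fZ.
have served_step u v : (u < p)%N -> served u v -> served u.+1 v.
  move=> up [f]; rewrite inE => /andP[fB fI] fv; have [cZ eqZ] := cZs u.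
  have [fZ|fZ] := boolP (f \in Zs u); first by rewrite -fv; exact: served_pop fZ.
  by exists f; rewrite // eqZ !inE fZ fB; rewrite inE in fI; rewrite fI.
have all_served v : v \in [set ad_head e | e in region_edges I] -> served p v.
  case/imsetP=> e; rewrite inE zetaI /zeta => ze ->.
  have [u up eZ] : exists2 u, (u < p)%N & e \in Zs u.
    apply: contrapT => noZ; move: ze.
    rewrite big_nat_cond big1 // => u /andP[/andP[_ up] _].
    by apply/eqP; rewrite eqb0; apply/negP => eZ; apply: noZ; exists u.
  have served_after w : (u < w <= p)%N -> served w (ad_head e).
    elim: w => // w IHw /andP[]; rewrite ltnS leq_eqVlt => /predU1P[<- _|uw wp].
      exact: served_pop.
    by apply: served_step => //; apply: IHw; rewrite uw ltnW.
  by apply: served_after; rewrite up leqnn.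
have := draconian I I_ne; rewrite ltnNge => /negP; apply.
have [_ <-] := gB p; rewrite weight_multidegree.
apply: leq_trans (leq_imset_card (@ad_head D) _); apply/subset_leq_card/subsetP.
by move=> v /all_served[f fI <-]; exact: imset_f.
Qed.

End CyclePopping.

(** * Hall-type existence and the support *)

Section SupportPolymatroid.
Variable D : alternating_dimap.
Local Notation V := (ad_vertex D).
Local Notation E := (ad_edge D).
Local Notation k := #|cw_regions D|.
Implicit Types (A B : {set E}) (r v : V) (I : {set 'I_k}) (a : 'X_{1..k}).

(** Exchange digraph: one unit of multidegree can move from region [i] to region [j] by replacing a
    chosen edge with another edge of the same head. *)
Definition transfer A : rel 'I_k := fun i j =>
  [exists e in A, [exists f, [&& region_index e == i, ad_head f == ad_head e
                               & region_index f == j]]].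

Lemma transferP A i j :
  reflect (exists e f, [/\ e \in A, region_index e = i, ad_head f = ad_head e
                         & region_index f = j]) (transfer A i j).
Proof.
apply: (iffP exists_inP) => [[e eA /existsP[f /and3P[/eqP ei /eqP fe /eqP fj]]]|].
  by exists e, f.
case=> e [f [eA ei fe fj]]; exists e => //; apply/existsP; exists f.
by rewrite ei fe fj !eqxx.
Qed.

Lemma in_choice_swap A r e f : in_choice A r -> e \in A -> ad_head f = ad_head e ->
  in_choice (f |: A :\ e) r.
Proof.
case=> no_r inj_head in_edge eA fe.
have other g : g \in A :\ e -> ad_head g != ad_head f.
  rewrite !inE => /andP[ge gA]; apply: contra ge => /eqP gf.
  by rewrite (inj_head g e gA eA) // gf.
split.
- by move=> g /setU1P[->|/setD1P[_ /no_r]] //; rewrite fe no_r.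
- move=> g h /setU1P[->|gA] /setU1P[->|hA] // eq_gh.
  + by have := other h hA; rewrite eq_gh eqxx.
  + by have := other g gA; rewrite eq_gh eqxx.
  + by move: gA hA => /setD1P[_ gA] /setD1P[_ hA]; exact: inj_head.
- move=> v /in_edge[g gA gv]; have [ge|ge] := eqVneq g e.
    by exists f; rewrite ?setU11 // fe -ge.
  by exists g; rewrite // !inE ge gA orbT.
Qed.

Lemma multidegree_swap A r e f l :
  in_choice A r -> e \in A -> ad_head f = ad_head e ->
  (multidegree (f |: A :\ e) l + (region_index e == l)
     = multidegree A l + (region_index f == l))%N.
Proof.
case=> _ inj_head _ eA fe; rewrite !mnm_sumE big_setU1 /=; last first.
  apply/negP => /setD1P[fe' fA]; case/eqP: fe'; exact: inj_head.
by rewrite [in RHS](big_setD1 e eA) /= !mnm1E; lia.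
Qed.

Lemma transfer_path A r i p :
  in_choice A r -> path (transfer A) i p -> uniq (i :: p) ->
  exists2 B, in_choice B r & forall l,
    (multidegree B l + (i == l) = multidegree A l + (last i p == l))%N.
Proof.
elim: p i A => [|j p IHp] i A cA; first by exists A.
rewrite [path _ _ _]/= [uniq _]/= => /andP[ij jp] /andP[i_jp up].
have /transferP[e [f [eA ei fe fj]]] := ij.
have cB := in_choice_swap cA eA fe.
(* The path does not return to [i], so its later steps use edges other than the removed [e] and
   survive the swap. *)
have jpB : path (transfer (f |: A :\ e)) j p.
  apply: (sub_in_path (P := fun l => l != i)) jp => [x y xi _|].
    case/transferP=> g [h [gA gx hg hy]]; apply/transferP.
    exists g, h; split=> //; rewrite !inE gA andbT.
    suff -> : g != e by rewrite orbT.
    by apply: contraNneq xi => ge; rewrite -gx ge ei.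
  by apply/allP => l ljp; apply: contraNneq i_jp => <-.
have [C cC degC] := IHp j _ cB jpB up; exists C => // l.
have := degC l; have := multidegree_swap l cA eA fe; rewrite ei fj /=; lia.
Qed.

Lemma in_choice_exists r : region_rank [set: 'I_k] = #|V|.-1 ->
  exists A, in_choice A r.
Proof.
move=> full.
have in_edge v : v != r -> exists e : E, ad_head e == v.
  move=> vr; have [T0|/region_rank_lt] := eqVneq [set: 'I_k] set0.
    have : (1 < #|V|)%N by apply/card_gt1P; exists v, r.
    by move: full; rewrite T0 region_rank0; lia.
  rewrite full prednK; last by apply/card_gt0P; exists r.
  set N := [set _ | _ in _] => cardN.
  have : v \in N.
    suff -> : N = setT by rewrite inE.
    by apply/eqP; rewrite eqEcard subsetT cardsT.
  by case/imsetP=> e _ ->; exists e.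
(* The pick depends only on the head, so a single edge is selected for each vertex. *)
exists [set e | (ad_head e != r) && ([pick f | ad_head f == ad_head e] == Some e)].
split.
- by move=> e; rewrite inE => /andP[].
- move=> e f; rewrite !inE => /andP[_ /eqP pe] /andP[_ /eqP pf] ef.
  by move: pf; rewrite -ef pe => -[].
- move=> v vr; case: (pickP (fun f : E => ad_head f == v)) => [f fv|no_f]; last first.
    by have [e ev] := in_edge v vr; have := no_f e; rewrite /= ev.
  have [e pe] : exists e, [pick f | ad_head f == v] = Some e.
    by case: pickP => [e _|/(_ f)]; [exists e | rewrite fv].
  have /eqP ev : ad_head e == v by move: pe; case: pickP => // g gv [<-].
  by exists e; rewrite // inE ev vr pe eqxx.
Qed.

Definition support_point a :=
  base_point (@region_rank D) a && (region_rank [set: 'I_k] == #|V|.-1).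

Lemma support_M_convex : M_convex support_point.
Proof.
move=> i a b /andP[Pa full] /andP[Pb _] lt_ba.
have [j [lt_ab Pa' Pb']] :=
  base_point_M_convex (@region_rank0 D) (@region_rank_submod D) Pa Pb lt_ba.
by exists j; split; rewrite // /support_point full andbT.
Qed.

Lemma mdeg_support_point a : support_point a -> mdeg a = #|V|.-1.
Proof. by case/andP=> /andP[_ /eqP ->] /eqP. Qed.

Lemma support_point_lt a I : support_point a -> I != set0 ->
  (weight a I < #|[set ad_head e | e in region_edges I]|)%N.
Proof.
case/andP=> /andP[/forallP/(_ I) leI _] _ I0.
exact: leq_ltn_trans leI (region_rank_lt I0).
Qed.

Lemma choice_of_support_point a r : support_point a ->
  exists2 A, in_choice A r & multidegree A = a.
Proof.
move=> Pa; have [A0 cA0] : exists A, in_choice A r.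
  by apply: in_choice_exists; apply/eqP; case/andP: Pa.
(* Truncated subtraction makes this the total excess over [a]. A transfer path from an overfull
   region to one with room lowers it. *)
pose dist A := (\sum_i (multidegree A i - a i))%N.
have [n le_n] := ubnP (dist A0); elim: n A0 cA0 le_n => // n IHn A cA le_n.
have deg_eq : mdeg (multidegree A) = mdeg a.
  by rewrite mdeg_multidegree (card_in_choice cA) mdeg_support_point.
have [deg_le|] := boolP [forall i, (multidegree A i <= a i)%N].
  have [_] := leqif_sum (P := predT) (fun i _ => leqif_eq (forallP deg_le i)).
  rewrite -!mdegE deg_eq eqxx => /esym/forallP eq_deg.
  by exists A => //; apply/mnmP => i; apply/eqP/(eq_deg i).
case/forallPn=> i; rewrite -ltnNge => lt_i.
(* If no region of Z had room left, the regions outside Z would be saturated: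
   every vertex on them other than r is entered from them. *)
pose Z := [set j | connect (transfer A) i j].
have iZ : i \in Z by rewrite inE connect0.
have [j jZ lt_j] : exists2 j, j \in Z & (multidegree A j < a j)%N.
  apply/exists_inP; apply: contraT => /exists_inPn ge_Z.
  have Z_gt : (weight a Z < weight (multidegree A) Z)%N.
    rewrite /weight (bigD1 i) //= [ltnRHS](bigD1 i) //= -addSn leq_add //.
    by apply: leq_sum => j /andP[/ge_Z + _]; rewrite -leqNgt.
  have Y_ge : (weight a (~: Z) <= weight (multidegree A) (~: Z))%N.
    have [->|Y0] := eqVneq (~: Z) set0; first by rewrite /weight !big_set0.
    rewrite -ltnS; apply: leq_trans (support_point_lt Pa Y0) _.
    rewrite weight_multidegree; set N := [set _ | _ in _].
    (* Only [r] may lack a chosen entering edge; the strict inequality of [support_point_lt] pays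
       for this extra vertex. *)
    have N_sub : N \subset r |: [set ad_head e | e in A :&: region_edges (~: Z)].
      apply/subsetP => v /imsetP[f]; rewrite inE => fY ->; rewrite !inE.
      have [//|fr] := eqVneq (ad_head f) r; have [_ _ in_edge] := cA.
      have [e eA ef] := in_edge _ fr; rewrite -ef imset_f // inE eA !inE /=.
      move: fY; rewrite !inE; apply: contra => ie.
      apply: connect_trans ie (connect1 _).
      by apply/transferP; exists e, f.
    apply: leq_trans (subset_leq_card N_sub) _; rewrite cardsU1 -[leqRHS]add1n.
    apply: leq_add; [exact: leq_b1 | exact: leq_imset_card].
  have wT c : (weight c Z + weight c (~: Z) = mdeg c)%N.
    by rewrite -weightT /weight [RHS](big_setID Z) /= setTI setTD.
  have := wT a; have := wT (multidegree A); lia.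
move: jZ; rewrite inE => /connectP[p0]; case/shortenP => p ip up _ {p0} jlast.
have [B cB degB] := transfer_path cA ip up.
have ij : i != j by apply: contraTneq lt_j => <-; lia.
rewrite ltnS in le_n; apply: (IHn B cB); apply: leq_trans le_n.
rewrite /dist (bigD1 i) // [ltnRHS](bigD1 i) //= -addSn leq_add //.
  have := degB i; rewrite -jlast eqxx [j == i]eq_sym (negPf ij) addn1 addn0 => degBi.
  by rewrite ltn_sub2r // -degBi.
apply: leq_sum => l li; have := degB l; rewrite -jlast [i == l]eq_sym (negPf li) /=.
rewrite addn0 => ->; case: (j =P l) => [<-|_]; last by rewrite addn0.
by rewrite addn1; move: lt_j; rewrite -subn_eq0 => /eqP ->.
Qed.

Lemma branching_support_point A r : branching A r -> support_point (multidegree A).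
Proof.
move=> bA; have V_gt0 : (0 < #|V|)%N by apply/card_gt0P; exists r.
have full : region_rank [set: 'I_k] = #|V|.-1.
  have := region_rank_max [set: 'I_k] r; have := branching_independent setT bA.
  have -> : A :&: region_edges setT = A by apply/setP => e; rewrite !inE andbT.
  by rewrite (card_in_choice (branching_in_choice bA)); lia.
rewrite /support_point full eqxx andbT; apply/andP; split.
  by apply/forallP => I; rewrite weight_multidegree; exact: branching_independent bA.
by rewrite mdeg_multidegree (card_in_choice (branching_in_choice bA)) full.
Qed.

Lemma support_point_branching a r : support_point a ->
  exists2 A, branching A r & multidegree A = a.
Proof.
move=> Pa; have [A cA degA] := choice_of_support_point r Pa.
rewrite -degA; apply: choice_branching => // I; rewrite degA.
exact: support_point_lt.
Qed.

(** [support_point_branching] gives a contributing arborescence and [branching_unique] makes it the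
    only one; the resulting value does not involve [r]. *)
Lemma mcoeff_M_poly (R : nzRingType) r a : (M_poly R r)@_a = (support_point a)%:R.
Proof.
have prodE A : \prod_(e in A) var R e = 'X_[multidegree A].
  by rewrite /multidegree (big_morph _ (@mpolyXD _ R) (@mpolyX0 _ R)).
rewrite /M_poly raddf_sum /=; under eq_bigr => A _ do rewrite prodE mcoeffX.
have [Pa|nPa] := boolP (support_point a); last first.
  apply: big1 => A /asboolP/arborescenceE/branching_support_point PA.
  by case: eqP => // degA; rewrite degA (negPf nPa) in PA.
have [A bA degA] := support_point_branching r Pa.
rewrite (bigD1 A) /=; last by apply/asboolP/arborescenceE.
rewrite degA eqxx big1 ?addr0 // => B /andP[/asboolP/arborescenceE bB BA].
case: eqP => // degB; case/eqP: BA; apply: branching_unique bB bA _ => i.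
have count (S : {set E}) : #|[set e in S | region_index e == i]| = multidegree S i.
  rewrite multidegreeE -[LHS]sum1_card [LHS]big_mkcond [RHS]big_mkcond.
  by apply: eq_bigr => e _; rewrite inE andbC; case: (_ == i); case: (e \in S).
by rewrite !count degA degB.
Qed.

End SupportPolymatroid.

Theorem theorem4p1 (R : realType) (D : alternating_dimap) :
  (forall r s : ad_vertex D, M_poly R r = M_poly R s) /\
  (forall r : ad_vertex D, denormalized_lorentzian (M_poly R r)).
Proof.
split=> [r s|r]; first by apply/mpolyP => a; rewrite !mcoeff_M_poly.
apply: denormalized_lorentzian_indicator (@mcoeff_M_poly D R r).
  exact: support_M_convex.
exact: mdeg_support_point.
Qed.
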